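(* Let $m=m(n)$ be a sequence of positive integers with $m(n)\to+\infty$ as $n\to+\infty$. For each $n\ge 1$ let $(X_{n,1},Q_{n,1}),\dots,(X_{n,m},Q_{n,m})$ be independent (not necessarily identically distributed) bivariate random variables with values in $\{0,1,\dots,n\}\times[0,1]$, and let $G_{[n,m]}$ be the community affiliation graph on the vertex set $[n]$ defined by this sequence. Let $i_*$ be uniformly distributed in $[m]$ and independent of the sequence $\{(X_{n,i},Q_{n,i}),\ i\in[m]\}$. Assume that, as $n\to+\infty$, $(X_{n,i_*},Q_{n,i_*})$ converges in distribution to some bivariate random variable $(X,Q)$ with values in $\{0,1,2,\dots\}\times[0,1]$ such that $$\mathbf{E}\bigl(Q\,\mathbb{I}_{\{X\ge 2\}}\bigr)>0\qquad\text{and}\qquad \mathbf{E}\bigl(X\,h(X,Q)\ln(1+X)\bigr)<\infty .$$ Assume, in addition, that $$\mathbf{E}\bigl(X_{n,i_*}h(X_{n,i_*},Q_{n,i_*})\ln(1+X_{n,i_*})\bigr)\to\mathbf{E}\bigl(X\,h(X,Q)\ln(1+X)\bigr)\qquad\text{as } n\to+\infty.$$ Put $$\kappa_n=\mathbf{E}\bigl(X_{n,i_*}h(X_{n,i_*},Q_{n,i_*})\bigr)=\frac1m\sum_{i\in[m]}\mathbf{E}\bigl(X_{n,i}h(X_{n,i},Q_{n,i})\bigr),\qquad \lambda_{n,m}=\ln n-\frac{m}{n}\kappa_n .$$ Then, as $n\to+\infty$: (i) if $\lambda_{n,m}\to+\infty$, then $\mathbf{P}\{G_{[n,m]}\text{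 is connected}\}\to 0$; (ii) if $\lambda_{n,m}\to-\infty$, then $\mathbf{P}\{G_{[n,m]}\text{ is connected}\}\to 1$.
   Context: Notation: $[n]=\{1,\dots,n\}$; $(a)_+=\max\{a,0\}$; $\mathbb{I}_{\mathcal A}$ is the indicator of the event $\mathcal A$. For $x\ge 0$ and $0\le q\le 1$ put $h(x,q)=1-(1-q)^{(x-1)_+}$, with the convention $0^0=1$. Random graph model: given independent bivariate random variables $(X_{n,1},Q_{n,1}),\dots,(X_{n,m},Q_{n,m})$ with values in $\{0,1,\dots,n\}\times[0,1]$, define independent random graphs (communities) $G_{n,i}=(\mathcal V_{n,i},\mathcal E_{n,i})$, $i\in[m]$, as follows. First sample $(X_{n,i},Q_{n,i})$. Then, given $(X_{n,i},Q_{n,i})$, select the vertex set $\mathcal V_{n,i}\subset[n]$ uniformly at random among all subsets of $[n]$ of size $X_{n,i}$, and link every pair of elements of $\mathcal V_{n,i}$ by an edge independently with probability $Q_{n,i}$; $\mathcal E_{n,i}$ is the resulting edge set. The community affiliation graph defined by the sequence is the graph $G_{[n,m]}=([n],\bigcup_{i\in[m]}\mathcal E_{n,i})$ with the non-random vertex set $[n]$. The random variable $(X_{n,i_*},Q_{n,i_*})$ has the mixture distribution $\mathbf{P}\{X_{n,i_*}=x,\,Q_{n,i_*}\in[0,t]\}=\frac1m\sum_{i\in[m]}\mathbf{P}\{X_{n,i}=x,\,Q_{n,i}\in[0,t]\}$. *)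

(* Defs.v *)
From HB Require Import structures.
From mathcomp Require Import all_boot all_order all_algebra.
From mathcomp Require Import all_classical all_reals all_analysis.

Set Implicit Arguments.
Unset Strict Implicit.
Unset Printing Implicit Defensive.
Import Order.TTheory GRing.Theory Num.Theory.
Import numFieldNormedType.Exports.

Local Open Scope classical_set_scope.
Local Open Scope ring_scope.

(* The convention 0^0 = 1 is that of [^+], and (x - 1)_+ is the truncated
   predecessor [x.-1]. *)
Definition hfun (R : realType) (x : nat) (q : R) : R := 1 - (1 - q) ^+ x.-1.

(* A graph whose vertex set is a subset of the n-element set 'I_n: the pair of
   its vertex set and its edge set, edges being two-element sets. *)
Definition community (n : nat) : Type :=
  ({set 'I_n} * {set {set 'I_n}})%type.

HB.instance Definition _ n :=
  Finite.copy (community n) ({set 'I_n} * {set {set 'I_n}})%type.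
HB.instance Definition _ n :=
  isPointed.Build (community n) (finset.set0, finset.set0).
HB.instance Definition _ n := @isMeasurable.Build default_measure_display
  (community n) (@discrete_measurable (community n))
  (@discrete_measurable0 _) (@discrete_measurableC _)
  (@discrete_measurableU _).

Definition vertices n (g : community n) : {set 'I_n} := g.1.
Definition edges n (g : community n) : {set {set 'I_n}} := g.2.

Definition vpairs n (V : {set 'I_n}) : {set {set 'I_n}} :=
  [set e : {set 'I_n} | (e \subset V) && (#|e| == 2)%N]%SET.

(* Conditional probability, given (X, Q) = (x, q), that the community is g:
   1 / C(n, x) for the choice of the vertex set among the subsets of size x,
   times a factor q for each linked pair and 1 - q for each unlinked pair. *)
Definition community_pmf (R : realType) n (x : nat) (q : R)
    (g : community n) : R :=
  if (#|vertices g| == x) && (edges g \subset vpairs (vertices g)) then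
    'C(n, x)%:R^-1 *
    \prod_(e in vpairs (vertices g)) (if e \in edges g then q else 1 - q)
  else 0.

Definition mutually_independent (R : realType) (d d' : measure_display)
    (T : measurableType d) (T' : measurableType d') (P : probability T R)
    (I : finType) (Y : I -> T -> T') : Prop :=
  forall (J : {set I}) (A : I -> set T'),
    (forall i, i \in J -> measurable (A i)) ->
    P (\bigcap_(i in [set i | i \in J]) Y i @^-1` A i) =
    (\prod_(i in J) P (Y i @^-1` A i))%E.

(* The independent pairs (X_i, Q_i), i < m, together with the independent
   random graphs they generate.  The last clause says that, given (X_i, Q_i),
   the graph G_i has the probability mass function [community_pmf]. *)
Definition is_community_sequence (R : realType) (d : measure_display)
    (T : measurableType d) (P : probability T R) (n m : nat)
    (X : 'I_m -> {RV P >-> nat}) (Q : 'I_m -> {RV P >-> R})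
    (G : 'I_m -> {RV P >-> community n}) : Prop :=
  [/\ forall i t, (X i t <= n)%N,
      forall i t, 0 <= Q i t <= 1,
      mutually_independent P (fun i t => (X i t, Q i t, G i t)) &
      forall i (x : nat) (B : set R) (g : community n), measurable B ->
        P [set t | [/\ X i t = x, B (Q i t) & G i t = g]] =
        (\int[P]_(t in [set t | X i t = x /\ B (Q i t)])
            (community_pmf x (Q i t) g)%:E)%E].

(* Independence of the sequence is expressed on measurable rectangles, which
   generate its sigma-algebra and are stable under intersection. *)
Definition is_uniform_index (R : realType) (d : measure_display)
    (T : measurableType d) (P : probability T R) (m : nat)
    (X : 'I_m -> {RV P >-> nat}) (Q : 'I_m -> {RV P >-> R})
    (istar : T -> 'I_m) : Prop :=
  [/\ forall k, measurable (istar @^-1` [set k]),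
      forall k, P (istar @^-1` [set k]) = (m%:R^-1)%:E &
      forall k (B : 'I_m -> set (nat * R)), (forall i, measurable (B i)) ->
        P (istar @^-1` [set k] `&`
           \bigcap_i (fun t => (X i t, Q i t)) @^-1` B i) =
        (P (istar @^-1` [set k]) *
         P (\bigcap_i (fun t => (X i t, Q i t)) @^-1` B i))%E].

Definition cvg_in_distribution (R : realType) (S : topologicalType)
    (d : nat -> measure_display) (T : forall n, measurableType (d n))
    (P : forall n, probability (T n) R) (Y : forall n, T n -> S)
    (d' : measure_display) (T' : measurableType d') (P' : probability T' R)
    (Y' : T' -> S) : Prop :=
  forall f : S -> R, continuous f -> (exists M : R, forall s, `|f s| <= M) ->
    ('E_(P n)[f \o Y n] @[n --> \oo] --> 'E_P'[f \o Y'])%E.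

Definition edge_rel n (E : {set {set 'I_n}}) : rel 'I_n :=
  fun u v => [set u; v]%SET \in E.

(* Connectedness of the graph with vertex set 'I_n and edge set E. *)
Definition connected_graph n (E : {set {set 'I_n}}) : bool :=
  [forall u, forall v, connect (edge_rel E) u v].

(* Edge set of the community affiliation graph. *)
Definition affiliation_edges n m (g : 'I_m -> community n) :
    {set {set 'I_n}} :=
  (\bigcup_(i < m) edges (g i))%SET.

(* Main.v *)
(* Write a_i(A) for the probability that community i has an edge leaving the
   vertex set A.  By independence, the union graph has no edge leaving A with
   probability prod_i (1 - a_i(A)).  If V is a uniform x-set which is neither
   disjoint from A nor contained in A, then at least x - 1 pairs in V leave A,
   so a_i(A) is at least E(h(X_i, Q_i) 1_{V crosses A}), with equality when A
   is a singleton; there sum_i a_i({v}) = (m / n) kappa_n = ln n - lambda.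

   (i) The second moment method for the number of isolated vertices.
   (ii) A union bound over the sets A with |A| = k <= n / 2.  For
   k <= n^(1 - gamma) the k vertices of A are nearly independent, which gives
   exp(k (lambda / 2 + 1)) for the sum over the sets A of size k; for larger k
   the crude bound sum_i a_i(A) >= (k / n) sum_i E h(X_i, Q_i) beats
   C(n, k) <= (e n / k)^k, since m / n is at least of order ln n.

   Convergence of the X h ln(1 + X) moment makes this variable uniformly
   integrable, so that ln n E(X h 1_{X > n^gamma}) tends to 0 for every
   gamma > 0: communities of size larger than n^gamma are negligible. *)
Require Import Defs.
From mathcomp Require Import all_boot all_order all_algebra.
From mathcomp Require Import all_classical all_reals all_analysis.
From mathcomp Require Import measurable_realfun.
From mathcomp Require Import ring lra zify.
Import Order.TTheory GRing.Theory Num.Theory.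
Import numFieldNormedType.Exports.

Set Implicit Arguments.
Unset Strict Implicit.
Unset Printing Implicit Defensive.

Local Open Scope ring_scope.

(** * Edges inside a random vertex set *)

(** Expand the product over all [e] of [a e + b e]. A pair of [F] has to be unlinked and contributes
    [1 - q]; every other pair contributes [q + (1 - q) = 1]. Since [a] vanishes outside [D :\: F],
    only the edge sets to be counted survive the expansion. *)
Lemma sum_edge_weights (R : realType) (I : finType) (D F : {set I}) (q : R) :
  F \subset D ->
  \sum_(E : {set I} | (E \subset D) && [disjoint E & F])
     \prod_(e in D) (if e \in E then q else 1 - q) = (1 - q) ^+ #|F|.
Proof.
move=> FD.
pose a e := if e \in (D :\: F)%SET then q else 0.
pose b e := if e \in D then 1 - q else 1.
transitivity (\prod_e (a e + b e)); last first.
  rewrite (bigID (mem F)) /= [X in _ * X]big1 ?mulr1.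
    rewrite (eq_bigr (fun=> 1 - q)) ?prodr_const // => e eF.
    by rewrite /a /b finset.in_setD eF /= add0r (fintype.subsetP FD).
  move=> e eF; rewrite /a /b finset.in_setD eF /=.
  by case: (e \in D); rewrite ?add0r // addrC subrK.
rewrite bigA_distr /= [RHS](bigID (fun J : {set I} => J \subset (D :\: F)%SET)) /=.
rewrite [X in _ = _ + X]big1 ?addr0 => [|J /fintype.subsetPn[e eJ eDF]]; last first.
  by rewrite (bigD1 e) //= eJ /a (negPf eDF) mul0r.
apply: eq_big => [E|E /andP[ED EF]]; first by rewrite finset.subsetD.
rewrite [RHS](bigID (mem D)) /= [X in _ = _ * X]big1 ?mulr1.
  apply: eq_bigr => e eD; case: ifPn => eE; rewrite /a /b ?eD //.
  by rewrite finset.in_setD eD (disjointFr EF).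
move=> e eD; rewrite ifF /b; last by apply: contraNF eD; apply: (fintype.subsetP ED).
by rewrite (negPf eD).
Qed.

(** The set of forbidden pairs may depend on the vertex set: summing over the edge sets first leaves
    an average over the uniform x-sets [V]. *)
Lemma sum_pmf_disjoint (R : realType) n x (q : R)
    (F : {set 'I_n} -> {set {set 'I_n}}) :
  (forall V, F V \subset vpairs V) ->
  \sum_(g : community n | [disjoint edges g & F (vertices g)])
     community_pmf x q g =
  'C(n, x)%:R^-1 * \sum_(V : {set 'I_n} | #|V| == x) (1 - q) ^+ #|F V|.
Proof.
move=> FV.
transitivity (\sum_(V : {set 'I_n}) \sum_(E : {set {set 'I_n}} | [disjoint E & F V])
    community_pmf x q ((V, E) : community n)).
  by rewrite pair_big_dep; apply: eq_big => [[]|[]].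
rewrite (bigID (fun V : {set 'I_n} => #|V| == x)) /= addrC big1 ?add0r; last first.
  by move=> V Vx; apply: big1 => E _; rewrite /community_pmf /= (negPf Vx).
rewrite mulr_sumr; apply: eq_bigr => V Vx.
rewrite -(sum_edge_weights q (FV V)) mulr_sumr.
rewrite (bigID (fun E : {set {set 'I_n}} => E \subset vpairs V)) /=.
rewrite [X in _ + X]big1 ?addr0 => [|E /andP[_ EV]]; last first.
  by rewrite /community_pmf /= (negPf EV) andbF.
apply: eq_big => [E|E /andP[_ EV]]; first by rewrite andbC.
by rewrite /community_pmf /= Vx EV.
Qed.

(** * Counting pairs and subsets *)

Lemma card_star n (V : {set 'I_n}) a : a \in V ->
  #|[set [set a; w] | w in (V :\ a)%SET]%SET| = #|V|.-1.
Proof.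
move=> aV; rewrite card_in_imset; first by rewrite (cardsD1 a V) aV.
move=> w w'; rewrite !finset.in_setD1 => /andP[wa _] /andP[wa' _] e.
have : w \in [set a; w']%SET by rewrite -e finset.set22.
by rewrite finset.in_set2 (negPf wa) => /eqP.
Qed.

Lemma set2_vpairs n (V : {set 'I_n}) a b : a \in V -> b \in V -> a != b ->
  [set a; b]%SET \in vpairs V.
Proof.
move=> aV bV ab; rewrite finset.inE cards2 ab eqxx andbT.
by apply/fintype.subsetP => z; rewrite finset.in_set2 => /orP[] /eqP ->.
Qed.

(** A community avoids [touching U V] when every vertex of [U] is isolated in it, and avoids
    [crossing U V] when none of its edges leaves [U]. *)
Definition touching n (U V : {set 'I_n}) : {set {set 'I_n}} :=
  [set e in vpairs V | ~~ [disjoint e & U]]%SET.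

Definition crossing n (U V : {set 'I_n}) : {set {set 'I_n}} :=
  [set e in vpairs V | ~~ [disjoint e & U] && ~~ (e \subset U)]%SET.

Lemma touching_sub n (U V : {set 'I_n}) : touching U V \subset vpairs V.
Proof. by apply/fintype.subsetP => e; rewrite finset.inE => /andP[]. Qed.

Lemma crossing_sub n (U V : {set 'I_n}) : crossing U V \subset vpairs V.
Proof. by apply/fintype.subsetP => e; rewrite finset.inE => /andP[]. Qed.

Lemma disjoint_set2 n (U : {set 'I_n}) (a b : 'I_n) :
  [disjoint [set a; b]%SET & U] = (a \notin U) && (b \notin U).
Proof.
by rewrite finset.disjoints_subset finset.subUset !finset.sub1set !finset.inE.
Qed.

(** The star inside [V] centred at a common vertex of [U] and [V] already provides enough pairs. *)
Lemma card_touching n (U V : {set 'I_n}) : ~~ [disjoint V & U] ->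
  (#|V|.-1 <= #|touching U V|)%N.
Proof.
rewrite disjoint_sym => /pred0Pn[a /= /andP[aU aV]].
rewrite -(card_star aV); apply/subset_leq_card/fintype.subsetP => e /imsetP[w].
rewrite finset.in_setD1 => /andP[wa wV] ->.
by rewrite finset.inE set2_vpairs ?disjoint_set2 ?aU // eq_sym.
Qed.

(** For a single vertex the star is everything; this equality makes the isolation probability in
    [sum_pmf_isolated] exact. *)
Lemma card_touching1 n (u : 'I_n) (V : {set 'I_n}) :
  #|touching [set u]%SET V| = if u \in V then #|V|.-1 else 0%N.
Proof.
case: ifPn => uV.
  rewrite -(card_star uV); apply: eq_card => e; apply/idP/imsetP.
    rewrite !finset.inE => /andP[/andP[eV /eqP/esym/eqP]].
    rewrite eq_sym => /cards2P[a [b [ab eab]]].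
    move: eV; rewrite eab disjoint_set2 !finset.in_set1 negb_and !negbK.
    rewrite finset.subUset !finset.sub1set => /andP[aV bV].
    case/orP => /eqP E; [exists b|exists a]; rewrite -?E // ?finset.in_setD1.
    - by rewrite eq_sym ab.
    - by rewrite ab.
    - by rewrite finset.setUC.
  case=> w; rewrite finset.in_setD1 => /andP[wu wV] ->.
  by rewrite finset.inE set2_vpairs ?disjoint_set2 ?finset.in_set1 ?eqxx // eq_sym.
apply: eq_card0 => e; rewrite !finset.inE finset.disjoints_subset.
apply/negbTE; rewrite negb_and negbK -implybE; apply/implyP => /andP[eV _].
apply/fintype.subsetP => z ze; rewrite finset.in_setC finset.in_set1.
by apply: contra uV => /eqP <-; apply: (fintype.subsetP eV).
Qed.

(** Choose [a] in [V] inside [U] and [b] in [V] outside [U], and join each other vertex [w] of [V]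
    to whichever of [a], [b] lies on the opposite side; [w = b] yields the pair {a, b}. *)
Lemma card_crossing n (U V : {set 'I_n}) :
  ~~ [disjoint V & U] -> ~~ (V \subset U) ->
  (#|V|.-1 <= #|crossing U V|)%N.
Proof.
rewrite disjoint_sym => /pred0Pn[a /= /andP[aU aV]] /fintype.subsetPn[b bV bU].
(* The pairs {a, w} with w outside U and {b, w} with w in U are distinct. *)
pose f w := (if w \in U then [set b; w] else [set a; w])%SET.
have abF : a != b by apply: contraNneq bU => <-.
have -> : #|V|.-1 = #|[set f w | w in (V :\ a)%SET]%SET|.
  rewrite card_in_imset; first by rewrite (cardsD1 a V) aV.
  move=> w w'; rewrite !finset.in_setD1 /f => /andP[wa _] /andP[wa' _].
  case: ifPn => wU; case: ifPn => wU' e.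
  - have : w \in [set b; w']%SET by rewrite -e finset.set22.
    rewrite finset.in_set2 => /orP[/eqP wb|/eqP //].
    by move: bU; rewrite -wb wU.
  - have : a \in [set b; w]%SET by rewrite e finset.set21.
    by rewrite finset.in_set2 (negPf abF) /= eq_sym (negPf wa).
  - have : a \in [set b; w']%SET by rewrite -e finset.set21.
    by rewrite finset.in_set2 (negPf abF) /= eq_sym (negPf wa').
  - have : w \in [set a; w']%SET by rewrite -e finset.set22.
    by rewrite finset.in_set2 (negPf wa) => /eqP.
apply/subset_leq_card/fintype.subsetP => e /imsetP[w].
rewrite finset.in_setD1 => /andP[wa wV] ->; rewrite /f finset.inE.
case: ifPn => wU.
  have bw : b != w by apply: contraNneq bU => ->.
  rewrite set2_vpairs ?disjoint_set2 ?wU ?andbF //= finset.subUset.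
  by rewrite !finset.sub1set (negPf bU).
rewrite set2_vpairs 1?eq_sym // disjoint_set2 aU /= finset.subUset.
by rewrite !finset.sub1set (negPf wU) andbF.
Qed.

(** A uniform x-subset of an n-set falls inside a fixed d-subset with probability at most (d / n)^x,
    because each factor (d - i) / (n - i) is at most d / n. *)
Lemma leq_bin_expn n d x : (d <= n)%N ->
  ('C(d, x) * n ^ x <= d ^ x * 'C(n, x))%N.
Proof.
move=> dn; rewrite -(leq_pmul2r (fact_gt0 x)) mulnAC bin_ffact.
rewrite -mulnA bin_ffact; elim: x => [|x IHx]; first by rewrite !ffactn0.
rewrite !ffactnSr !expnSr.
have -> : (d ^_ x * (d - x) * (n ^ x * n) = (d ^_ x * n ^ x) * ((d - x) * n))%N by ring.
have -> : (d ^ x * d * (n ^_ x * (n - x)) = (d ^ x * n ^_ x) * (d * (n - x)))%N by ring.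
rewrite leq_mul // mulnBl mulnBr leq_sub2l //.
by rewrite (mulnC x) leq_mul2r dn orbT.
Qed.

(** * Conditional probability that a community avoids a set of pairs *)

Lemma hfun_itv (R : realType) x (q : R) : 0 <= q <= 1 -> 0 <= hfun x q <= 1.
Proof.
move=> /andP[q0 q1]; have q1' : 0 <= 1 - q <= 1 by apply/andP; split; lra.
case/andP: (q1') => a0 a1; rewrite /hfun.
have := exprn_ge0 x.-1 a0; have := exprn_ile1 x.-1 a0 a1.
by move=> ? ?; apply/andP; split; lra.
Qed.

Lemma hfun_le1 (R : realType) x (q : R) : (x <= 1)%N -> hfun x q = 0.
Proof. by case: x => [|[|]] // _; rewrite /hfun expr0 subrr. Qed.

(** [N] collects the exceptional vertex sets, a fraction at most [r] of all x-sets, where the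
    probability is bounded by 1. Elsewhere it is at most (1 - q)^(x - 1) = 1 - h, and r + (1 - r)(1
    - h) = 1 - h (1 - r). *)
Lemma sum_pmf_disjoint_le (R : realType) n x (q r : R)
    (F : {set 'I_n} -> {set {set 'I_n}}) (N : pred {set 'I_n}) :
  (x <= n)%N -> 0 <= q <= 1 -> (forall V, F V \subset vpairs V) ->
  (forall V, ~~ N V -> (#|V|.-1 <= #|F V|)%N) ->
  #|[set V : {set 'I_n} | (#|V| == x) && N V]%SET|%:R <= r * 'C(n, x)%:R ->
  \sum_(g : community n | [disjoint edges g & F (vertices g)])
     community_pmf x q g <= 1 - hfun x q * (1 - r).
Proof.
move=> xn q01 FV NF Nr; rewrite sum_pmf_disjoint //.
have C0 : 0 < 'C(n, x)%:R :> R by rewrite ltr0n bin_gt0.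
rewrite ler_pdivrMl //.
have /andP[q0 q1] := q01; have a0 : 0 <= 1 - q by lra.
have a1 : 1 - q <= 1 by lra.
pose c := #|[set V : {set 'I_n} | (#|V| == x) && ~~ N V]%SET|.
have Cc : 'C(n, x)%:R = #|[set V : {set 'I_n} | (#|V| == x) && N V]%SET|%:R + c%:R :> R.
  rewrite -natrD; congr (_%:R).
  have <- : #|[set V : {set 'I_n} | #|V| == x]%SET| = 'C(n, x).
    by rewrite card_draws card_ord.
  rewrite -(cardsID [set V | N V]%SET); congr (_ + _)%N;
    by apply: eq_card => V; rewrite !finset.inE // andbC.
apply: (@le_trans _ _ (#|[set V : {set 'I_n} | (#|V| == x) && N V]%SET|%:R
   + c%:R * (1 - hfun x q))); last first.
  have /andP[h0 h1] := hfun_itv x q01.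
  have := ler_wpM2l h0 Nr; rewrite Cc => H.
  move: H; set A := #|_|%:R; set B := c%:R; set h := hfun x q => H.
  have -> : (A + B) * (1 - h * (1 - r)) = A + B * (1 - h) + (h * (r * (A + B)) - h * A) by ring.
  by rewrite lerDl subr_ge0.
rewrite (bigID N) /= lerD //.
  rewrite -sum1dep_card natr_sum ler_sum // => V _.
  by rewrite exprn_ile1.
rewrite /c -sum1dep_card natr_sum mulr_suml ler_sum // => V /andP[/eqP Vx NV].
rewrite mul1r /hfun subKr -Vx.
by rewrite ler_wiXn2l // NF.
Qed.

(** A uniform x-set contains [u] with probability x / n, and then [u] is isolated with probability 1
    - h. *)
Lemma sum_pmf_isolated (R : realType) n x (q : R) (u : 'I_n) :
  (x <= n)%N -> 0 <= q <= 1 ->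
  \sum_(g : community n | [disjoint edges g & touching [set u]%SET (vertices g)])
     community_pmf x q g = 1 - x%:R * hfun x q / n%:R.
Proof.
move=> xn q01; rewrite sum_pmf_disjoint; last by move=> V; apply: touching_sub.
have n0 : (0 < n)%N by apply: leq_trans (ltn_ord u).
have nn : n%:R != 0 :> R by rewrite pnatr_eq0 -lt0n.
have C0 : 'C(n, x)%:R != 0 :> R by rewrite pnatr_eq0 -lt0n bin_gt0.
apply: (canLR (mulKf C0)).
rewrite (bigID (fun V : {set 'I_n} => u \notin V)) /=.
have cN : #|[set V : {set 'I_n} | (#|V| == x) && (u \notin V)]%SET| = 'C(n.-1, x).
  rewrite -[in RHS](_ : #|(~: [set u])%SET| = n.-1); last first.
    by rewrite cardsC1 card_ord.
  rewrite -cards_draws; apply: eq_card => V; rewrite !finset.inE andbC.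
  by rewrite -finset.disjoints_subset disjoint_sym finset.disjoints_subset finset.sub1set finset.inE.
have cA : #|[set V : {set 'I_n} | #|V| == x]%SET| = 'C(n, x).
  by rewrite card_draws card_ord.
have cP : #|[set V : {set 'I_n} | (#|V| == x) && ~~ (u \notin V)]%SET|%:R = 'C(n, x)%:R - 'C(n.-1, x)%:R :> R.
  apply/eqP; rewrite eq_sym subr_eq -natrD eqr_nat -cN -cA.
  rewrite -(cardsID [set V : {set 'I_n} | u \in V]%SET); apply/eqP; congr (_ + _)%N;
    apply: eq_card => V; rewrite !finset.inE ?negbK //.
  by rewrite andbC.
have E1 : \sum_(V : {set 'I_n} | (#|V| == x) && (u \notin V))
   (1 - q) ^+ #|touching [set u]%SET V| = 'C(n.-1, x)%:R.
  rewrite -cN -sum1dep_card natr_sum; apply: eq_bigr => V /andP[_ uV].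
  by rewrite card_touching1 (negPf uV).
have E2 : \sum_(V : {set 'I_n} | (#|V| == x) && ~~ (u \notin V))
   (1 - q) ^+ #|touching [set u]%SET V| = ('C(n, x)%:R - 'C(n.-1, x)%:R) * (1 - hfun x q).
  rewrite -cP -sum1dep_card natr_sum mulr_suml; apply: eq_bigr => V /andP[/eqP Vx].
  by rewrite negbK => uV; rewrite card_touching1 uV Vx mul1r /hfun subKr.
rewrite E1 E2.
have : n%:R * 'C(n.-1, x)%:R = (n%:R - x%:R) * 'C(n, x)%:R :> R.
  by rewrite -natrB // -!natrM mul_bin_down.
set C := 'C(n, x)%:R; set C' := 'C(n.-1, x)%:R => E.
have -> : C' = (n%:R - x%:R) * C / n%:R by rewrite -E mulrC mulKf.
by field.
Qed.

(** A Bonferroni-type bound by induction on [x]; the inductive step has slack (t^2 + x^2 t^3) /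
    2. *)
Lemma expr1B_le (R : realType) (t : R) x : 0 <= t <= 1 ->
  (1 - t) ^+ x <= 1 - x%:R * t + (x%:R * t) ^+ 2 / 2.
Proof.
move=> /andP[t0 t1]; elim: x => [|x IHx].
  by rewrite expr0 mul0r expr0n /= subr0 mul0r addr0.
have t1' : 0 <= 1 - t by lra.
rewrite exprSr; apply: le_trans (ler_wpM2r t1' IHx) _.
rewrite -natr1; have : 0 <= x%:R :> R by [].
set y := x%:R => y0; have H1 : 0 <= t ^+ 2 by rewrite exprn_ge0.
have H2 : 0 <= y ^+ 2 * t ^+ 3 by rewrite mulr_ge0 ?exprn_ge0.
rewrite -subr_ge0 [X in 0 <= X](_ : _ = (t ^+ 2 + y ^+ 2 * t ^+ 3) / 2).
  by rewrite divr_ge0 // addr_ge0.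
by field.
Qed.

(** The exceptional vertex sets are those that miss both [u] and [v], a fraction at most (1 - 2 /
    n)^x. Writing w = x / n, this is at most 1 - 2 w + 2 w^2, and the quadratic term is absorbed by
    [delta] for small communities and by the tail indicator for large ones. *)
Lemma sum_pmf_isolated2 (R : realType) n x (q delta : R) (u v : 'I_n) :
  (x <= n)%N -> 0 <= q <= 1 -> 0 <= delta -> u != v ->
  \sum_(g : community n | [disjoint edges g & touching [set u; v]%SET (vertices g)])
     community_pmf x q g <=
  1 - 2 / n%:R * (1 - delta) * (x%:R * hfun x q)
    + 2 / n%:R * (x%:R * hfun x q * (delta * n%:R < x%:R)%R%:R).
Proof.
move=> xn q01 d0 uv.
have n2 : (2 <= n)%N.
  by rewrite -[n]card_ord -[2%N](_ : #|[set u; v]%SET| = _) ?max_card // cards2 uv.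
have n0 : 0 < n%:R :> R by rewrite ltr0n; apply: leq_trans n2.
pose t : R := 2 / n%:R.
have t01 : 0 <= t <= 1.
  by rewrite divr_ge0 //= ler_pdivrMr // mul1r ler_nat.
apply: le_trans (sum_pmf_disjoint_le (r := (1 - t) ^+ x)
   (N := fun V => [disjoint V & [set u; v]%SET]) xn q01 _ _ _) _.
- by move=> V; apply: touching_sub.
- by move=> V; apply: card_touching.
- have -> : #|[set V : {set 'I_n} | (#|V| == x) && [disjoint V & [set u; v]%SET]]%SET|
     = 'C((n - 2)%N, x).
    have <- : #|(~: [set u; v])%SET| = (n - 2)%N.
      by rewrite cardsCs finset.setCK cards2 uv card_ord.
    rewrite -cards_draws; apply: eq_card => V; rewrite !finset.inE andbC.
    by rewrite finset.disjoints_subset.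
  have := leq_bin_expn x (leq_subr 2 n).
  rewrite -(ler_nat R) !natrM !natrX natrB // => H.
  have -> : 1 - t = (n%:R - 2) / n%:R by rewrite /t mulrBl divff // gt_eqF.
  by rewrite expr_div_n mulrAC ler_pdivlMr // exprn_gt0.
have /andP[h0 h1] := hfun_itv x q01.
(* Here x / n is at most [delta] unless x > delta n, in which case x / n <= 1 suffices. *)
have X : x%:R / n%:R * (x%:R / n%:R) <= x%:R / n%:R * (delta + (delta * n%:R < x%:R)%R%:R) :> R.
  apply: ler_wpM2l; first by rewrite divr_ge0.
  case: ltP => H; last by rewrite addr0 ler_pdivrMr.
  apply: (@le_trans _ _ 1); last by rewrite lerDr.
  by rewrite ler_pdivrMr // mul1r ler_nat.
have := expr1B_le x t01.
have -> : x%:R * t = 2 * (x%:R / n%:R) by rewrite /t; ring.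
set y := (1 - t) ^+ x; set w := x%:R / n%:R in X *; set ind := _%:R in X *.
move=> Y; have {}Y : y <= 1 - 2 * w + 2 * (w * (delta + ind)) by nra.
have -> : 1 - 2 / n%:R * (1 - delta) * (x%:R * hfun x q) + 2 / n%:R * (x%:R * hfun x q * ind) =
  1 - hfun x q * (2 * w - 2 * (w * (delta + ind))).
  by rewrite /w; field; rewrite gt_eqF.
by rewrite lerD2l lerN2 ler_wpM2l //; lra.
Qed.

(** The exceptional vertex sets are those disjoint from [U] or contained in [U]; with p = |U| / n
    their fractions are at most (1 - p)^x and p^x. *)
Lemma sum_pmf_uncrossed (R : realType) n x (q : R) (U : {set 'I_n}) :
  (0 < n)%N -> (x <= n)%N -> 0 <= q <= 1 ->
  \sum_(g : community n | [disjoint edges g & crossing U (vertices g)])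
     community_pmf x q g <=
  1 - hfun x q * (1 - ((1 - #|U|%:R / n%:R) ^+ x + (#|U|%:R / n%:R) ^+ x)).
Proof.
move=> n0 xn q01; apply: (sum_pmf_disjoint_le
   (N := fun V => [disjoint V & U] || (V \subset U)) xn q01).
- by move=> V; apply: crossing_sub.
- by move=> V; rewrite negb_or => /andP[] *; apply: card_crossing.
have n0' : 0 < n%:R :> R by rewrite ltr0n.
have kn : (#|U| <= n)%N by rewrite -[n in (_ <= n)%N]card_ord max_card.
have B (W : {set 'I_n}) : 'C(#|W|, x)%:R <= (#|W|%:R / n%:R) ^+ x * 'C(n, x)%:R :> R.
  have Wn : (#|W| <= n)%N by rewrite -[n in (_ <= n)%N]card_ord max_card.
  have := leq_bin_expn x Wn.
  rewrite -(ler_nat R) !natrM !natrX => H.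
  by rewrite expr_div_n mulrAC ler_pdivlMr // exprn_gt0.
have -> : 1 - #|U|%:R / n%:R = #|(~: U)%SET|%:R / n%:R :> R.
  by rewrite (cardsCs (~: U)%SET) finset.setCK card_ord natrB // mulrBl divff // gt_eqF.
rewrite mulrDl; apply: le_trans (lerD (B _) (B _)).
rewrite -natrD ler_nat -!cards_draws.
apply: leq_trans (leq_card_setU _ _); apply/subset_leq_card/fintype.subsetP => V.
by rewrite !finset.inE finset.disjoints_subset => /andP[-> /orP[]->]; rewrite ?orbT.
Qed.

(** The crude bound for large sets. For x >= 2 and p <= 1/2 one has 1 - p^x - (1 - p)^x >= 1 - p^2 -
    (1 - p)^2 = 2 p (1 - p) >= p; for x <= 1, [hfun] vanishes. *)
Lemma sum_pmf_uncrossed_card (R : realType) n x (q : R) (U : {set 'I_n}) :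
  (0 < n)%N -> (x <= n)%N -> 0 <= q <= 1 -> (#|U|.*2 <= n)%N ->
  \sum_(g : community n | [disjoint edges g & crossing U (vertices g)])
     community_pmf x q g <= 1 - #|U|%:R / n%:R * hfun x q.
Proof.
move=> n0 xn q01 kn; apply: le_trans (sum_pmf_uncrossed U n0 xn q01) _.
have [x1|x2] := leqP x 1; first by rewrite hfun_le1 // mulr0 mul0r.
have /andP[h0 h1] := hfun_itv x q01.
rewrite lerD2l lerN2 mulrC ler_wpM2l //.
have n0' : 0 < n%:R :> R by rewrite ltr0n.
set p := _ / _; have p0 : 0 <= p by rewrite divr_ge0.
have p1 : p <= 2^-1.
  by rewrite ler_pdivrMr // ler_pdivlMl // -natrM ler_nat mul2n.
have H1 : p ^+ x <= p ^+ 2 by rewrite ler_wiXn2l //; lra.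
have H2 : (1 - p) ^+ x <= (1 - p) ^+ 2 by rewrite ler_wiXn2l //; lra.
by nra.
Qed.

(** The sharp bound for small sets. Communities with x > b are given up: for them the right-hand
    side is 1. For 2 <= x <= b, [expr1B_le] and p^x <= p^2 <= (x p)^2 / 2 leave at least x p - (x
    p)^2 >= x p (1 - b p). *)
Lemma sum_pmf_uncrossed_trunc (R : realType) n x (q b : R) (U : {set 'I_n}) :
  (0 < n)%N -> (x <= n)%N -> 0 <= q <= 1 -> b * (#|U|%:R / n%:R) <= 1 ->
  \sum_(g : community n | [disjoint edges g & crossing U (vertices g)])
     community_pmf x q g <=
  1 - #|U|%:R / n%:R * (1 - b * (#|U|%:R / n%:R)) *
      (x%:R * hfun x q - x%:R * hfun x q * (b < x%:R)%R%:R).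
Proof.
move=> n0 xn q01; have n0' : 0 < n%:R :> R by rewrite ltr0n.
have kn : (#|U| <= n)%N by rewrite -[n in (_ <= n)%N]card_ord max_card.
have := sum_pmf_uncrossed U n0 xn q01.
have : 0 <= #|U|%:R / n%:R :> R by rewrite divr_ge0.
have : #|U|%:R / n%:R <= 1 :> R by rewrite ler_pdivrMr // mul1r ler_nat.
set p := #|U|%:R / n%:R => p1 p0 H bp; apply: le_trans H _.
have [x1|x2] := leqP x 1; first by rewrite hfun_le1 // mulr0 !mul0r subrr mulr0.
have /andP[h0 h1] := hfun_itv x q01.
have a0 : 0 <= 1 - p by lra.
have a1 : 1 - p <= 1 by lra.
have x0 : (0 < x)%N by apply: leq_trans x2.
case: ltP => bx.
  rewrite mulr1 subrr mulr0 subr0 gerBl mulr_ge0 //.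
  have : p ^+ x <= p ^+ 1 by rewrite ler_wiXn2l.
  have : (1 - p) ^+ x <= (1 - p) ^+ 1 by rewrite ler_wiXn2l.
  by rewrite !expr1; lra.
rewrite mulr0 subr0 lerD2l lerN2.
have -> : p * (1 - b * p) * (x%:R * hfun x q) = hfun x q * (x%:R * p * (1 - b * p)) by ring.
apply: ler_wpM2l => //.
have Y : (1 - p) ^+ x <= 1 - x%:R * p + (x%:R * p) ^+ 2 / 2.
  by apply: expr1B_le; rewrite p0.
have Z : p ^+ x <= p ^+ 2 by rewrite ler_wiXn2l.
have x2' : 2 <= x%:R :> R by rewrite ler_nat.
have W : x%:R * p * (x%:R * p) <= x%:R * p * (b * p).
  by rewrite ler_wpM2l ?mulr_ge0 // ler_wpM2r.
have V : 2 * p <= x%:R * p by rewrite ler_wpM2r.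
have V2 : p ^+ 2 <= (x%:R * p) ^+ 2 / 2 by nra.
move: W Y Z V2; set xp := x%:R * p => W Y Z V2; by nra.
Qed.

(** * Independent communities *)

(** The joint law of independent communities; with it the two probabilistic bounds below are
    statements about finite sums. *)
Definition product_pmf (R : realType) (I J : finType) (p : I -> J -> R)
  (f : {ffun I -> J}) : R := \prod_i p i (f i).

Section product_pmf.
Context (R : realType) (I J : finType) (p : I -> J -> R).
Hypothesis p_ge0 : forall i g, 0 <= p i g.
Hypothesis p_sum1 : forall i, \sum_g p i g = 1.

Lemma product_pmf_ge0 f : 0 <= product_pmf p f.
Proof. exact: prodr_ge0. Qed.

Lemma sum_product_pmf (D : pred J) :
  \sum_(f : {ffun I -> J} | [forall i, D (f i)]) product_pmf p f =
  \prod_i \sum_(g | D g) p i g.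
Proof.
rewrite bigA_distr_big; apply: eq_bigl => f; apply/forallP/ffun_onP => //.
Qed.

Lemma sum_product_pmf1 : \sum_f product_pmf p f = 1.
Proof.
transitivity (\prod_i \sum_(g | xpredT g) p i g); last by apply: big1.
by rewrite -sum_product_pmf; apply: eq_bigl => f; apply/esym/forallP.
Qed.

(** The inclusion of events is required on the support only, since [isolated_disconnected] needs
    edges that join vertices of their community. *)
Lemma sum_product_pmf_le (D D' : pred {ffun I -> J}) :
  (forall f, D f -> product_pmf p f != 0 -> D' f) ->
  \sum_(f | D f) product_pmf p f <= \sum_(f | D' f) product_pmf p f.
Proof.
move=> DD'; rewrite [leLHS]big_mkcond [leRHS]big_mkcond /= ler_sum // => f _.
case: ifPn => Df; last by case: ifP => // _; apply: product_pmf_ge0.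
have [->|f0] := eqVneq (product_pmf p f) 0; first by case: ifP.
by rewrite DD'.
Qed.

End product_pmf.

(** Chebyshev's inequality: (N - mu)^2 equals mu^2 on the event N = 0. *)
Lemma second_moment (R : realType) (Omega : finType) (w N : Omega -> R) :
  (forall f, 0 <= w f) -> \sum_f w f = 1 ->
  (\sum_(f | N f == 0) w f) * (\sum_f w f * N f) ^+ 2 <=
  \sum_f w f * N f ^+ 2 - (\sum_f w f * N f) ^+ 2.
Proof.
move=> w0 w1; set mu := \sum_f w f * N f.
apply: (@le_trans _ _ (\sum_f w f * (N f - mu) ^+ 2)).
  rewrite mulr_suml big_mkcond /= ler_sum // => f _.
  case: eqP => [->|_]; first by rewrite sub0r sqrrN.
  by rewrite mulr_ge0 // sqr_ge0.
rewrite (eq_bigr (fun f => w f * N f ^+ 2 - 2 * mu * (w f * N f) + mu ^+ 2 * w f)).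
  rewrite big_split /= sumrB -!mulr_sumr w1 -/mu mulr1.
  by rewrite le_eqVlt; apply/orP; left; apply/eqP; ring.
by move=> f _; ring.
Qed.

(** Take inverses: 1 / (1 - a) = 1 + a / (1 - a) <= exp(a / (1 - a)), and a / (1 - a) <= a + 2 a^2
    for a <= 1/2. *)
Lemma expR_geB1 (R : realType) (a : R) : 0 <= a <= 2^-1 ->
  expR (- a - 2 * a ^+ 2) <= 1 - a.
Proof.
move=> /andP[a0 a1]; have a1' : 0 < 1 - a by lra.
have E : 1 + a / (1 - a) = (1 - a)^-1 by field; rewrite gt_eqF.
have E0 : 0 < 1 + a / (1 - a) by rewrite E invr_gt0.
rewrite -[leRHS]invrK -E -[leLHS]invrK -expRN lef_pV2 ?posrE ?expR_gt0 //.
apply: le_trans (expR_ge1Dx _) _.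
rewrite ler_expR -subr_ge0.
have -> : - (- a - 2 * a ^+ 2) - a / (1 - a) = a ^+ 2 * (1 - 2 * a) / (1 - a).
  by field; rewrite gt_eqF.
by rewrite divr_ge0 ?mulr_ge0 ?exprn_ge0 //; lra.
Qed.

Lemma touchingU n (U W V : {set 'I_n}) :
  touching (U :|: W)%SET V = (touching U V :|: touching W V)%SET.
Proof.
apply/finset.setP => e; rewrite finset.in_setU !finset.in_set -andb_orr -negb_and.
congr (_ && ~~ _); rewrite -!finset.setI_eq0 finset.setIUr.
by rewrite finset.setU_eq0.
Qed.

Definition isolated n m (u : 'I_n) (f : {ffun 'I_m -> community n}) :=
  [forall i, [disjoint edges (f i) & touching [set u]%SET (vertices (f i))]].

(** A path from [u] to a second vertex would begin with an edge at [u], which belongs to some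
    community and touches [u] there. *)
Lemma isolated_disconnected n m (u : 'I_n) (f : {ffun 'I_m -> community n}) :
  (1 < n)%N -> (forall i, edges (f i) \subset vpairs (vertices (f i))) ->
  isolated u f -> ~~ connected_graph (affiliation_edges f).
Proof.
move=> n1 fV /forallP iso; apply/negP => /forallP/(_ u)/forallP conn.
have [v vu] : exists v : 'I_n, v != u.
  have : (0 < #|[set~ u]%SET|)%N by rewrite cardsC1 card_ord; case: (n) n1 => [|[]].
  by case/card_gt0P => v; rewrite finset.in_setC1; exists v.
have /connectP[[|w s]] := conn v; first by move=> _ /= vE; rewrite vE eqxx in vu.
move=> /= /andP[/bigcupP[i _ e] _] _.
have := iso i; rewrite -setI_eq0 => /eqP/setP/(_ [set u; w]%SET).
rewrite finset.in_setI finset.in_set0 finset.in_set e (fintype.subsetP (fV i)) //= disjoint_set2 finset.in_set1 eqxx.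
by [].
Qed.

(** Take the connected component of [u], or its complement if the component has more than n / 2
    vertices; no edge leaves either of them. *)
Lemma disconnected_uncrossed n m (f : {ffun 'I_m -> community n}) :
  ~~ connected_graph (affiliation_edges f) ->
  exists U : {set 'I_n}, [/\ (0 < #|U|)%N, (#|U|.*2 <= n)%N &
    [forall i, [disjoint edges (f i) & crossing U (vertices (f i))]]].
Proof.
case/forallPn => u /forallPn[v uv].
set e := edge_rel _ in uv.
have esym : symmetric e by move=> x y; rewrite /e /edge_rel finset.setUC.
have eij x y i : [set x; y]%SET \in edges (f i) -> connect e x y.
  by move=> xy; apply: connect1; apply/bigcupP; exists i.
pose U := [set w | connect e u w]%SET.
have HU (x y : 'I_n) i : [set x; y]%SET \in edges (f i) -> x \in U -> y \in U.
  by rewrite !finset.inE => /eij xy /connect_trans; apply.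
have cross (W : {set 'I_n}) : (forall x y i, [set x; y]%SET \in edges (f i) -> x \in W -> y \in W) ->
    [forall i, [disjoint edges (f i) & crossing W (vertices (f i))]].
  move=> HW; apply/forallP => i; rewrite disjoint_subset; apply/fintype.subsetP => E Ef.
  rewrite !finset.inE; apply/negP => /andP[/andP[_ /cards2P[x [y [xy Exy]]]]].
  move: Ef; rewrite Exy disjoint_set2 finset.subUset !finset.sub1set => Ef.
  rewrite !negb_and !negbK => /andP[/orP[]] H /orP[] /negP; apply => //.
  - by apply: HW Ef H.
  - by apply: HW H; rewrite finset.setUC; apply: Ef.
have [k|k] := leqP (#|U|.*2) n.
  exists U; split => //; last exact: cross.
  by apply/card_gt0P; exists u; rewrite finset.inE connect0.
exists (~: U)%SET; split.
- by apply/card_gt0P; exists v; rewrite !finset.inE.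
- rewrite cardsCs finset.setCK card_ord; move: k; move: #|U| => c k; rewrite -!addnn in k *; lia.
- apply: cross => x y i xy; rewrite !finset.in_setC; apply: contra.
  by apply: (HU _ _ i); rewrite finset.setUC.
Qed.

(** * Second moment bound for isolated vertices and union bound for cuts *)

Section bounds.
Context (R : realType) (n m : nat) (p : 'I_m -> community n -> R).
Hypothesis p_ge0 : forall i g, 0 <= p i g.
Hypothesis p_sum1 : forall i, \sum_g p i g = 1.
Hypothesis p_supp : forall i g,
  ~~ (edges g \subset vpairs (vertices g)) -> p i g = 0.

Let connected (f : {ffun 'I_m -> community n}) :=
  connected_graph (affiliation_edges f).

(** [alpha i] is the probability that a given vertex is not isolated in community i, and [gamma i]
    the share of large communities. With N the number of isolated vertices, P1 the product of the 1
    - alpha_i, A their sum of alpha_i and S the error, E N = n P1, P1 >= exp(-A - 2 S), and two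
    given vertices are both isolated with probability at most exp(-2 A + 2 S). Then E N^2 / (E N)^2
    - 1 gives the two exponentials. *)
Lemma prob_connected_le (alpha gamma : 'I_m -> R) (delta : R) :
  (1 < n)%N -> 0 <= delta -> (forall i, 0 <= gamma i) ->
  delta + \sum_i gamma i <= 2^-1 ->
  (forall i, 0 <= alpha i <= delta + gamma i) ->
  (forall i u, \sum_(g : community n |
      [disjoint edges g & touching [set u]%SET (vertices g)]) p i g = 1 - alpha i) ->
  (forall i u v, u != v -> \sum_(g : community n |
      [disjoint edges g & touching [set u; v]%SET (vertices g)]) p i g <=
      1 - 2 * (1 - delta) * alpha i + 2 * gamma i) ->
  \sum_(f | connected f) product_pmf p f <=
    expR (\sum_i alpha i - ln n%:R
          + 2 * (delta * \sum_i alpha i + \sum_i gamma i))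
    + expR (6 * (delta * \sum_i alpha i + \sum_i gamma i)) - 1.
Proof.
move=> n1 d0 g0 dg adg p1 p2.
set A := \sum_i alpha i; set S := delta * A + _.
have w0 f : 0 <= product_pmf p f by apply: product_pmf_ge0.
have n0 : 0 < n%:R :> R by rewrite ltr0n; apply: ltnW.
have expL : expR (ln n%:R) = n%:R :> R by rewrite lnK // posrE.
have a0 i : 0 <= alpha i by case/andP: (adg i).
have gG i : gamma i <= \sum_i gamma i.
  by rewrite (bigD1 i) //= lerDl sumr_ge0.
have aS2 i : 0 <= alpha i <= 2^-1.
  by have /andP[-> /=] := adg i; have := gG i; lra.
(* Termwise, alpha^2 <= alpha (delta + gamma) <= delta alpha + gamma, because alpha <= 1. *)
have S2 : \sum_i alpha i ^+ 2 <= S.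
  rewrite /S /A mulr_sumr -big_split /= ler_sum // => i _.
  have := adg i; have := aS2 i; have := g0 i; have := d0.
  by set a := alpha i; set g := gamma i; nra.
pose N (f : {ffun 'I_m -> community n}) : R := \sum_u (isolated u f)%:R.
have I1 u : \sum_(f | isolated u f) product_pmf p f = \prod_i (1 - alpha i).
  rewrite (sum_product_pmf p (fun g => [disjoint edges g & touching [set u]%SET (vertices g)])).
  by apply: eq_bigr.
have I2 u v : u != v -> \sum_(f | isolated u f && isolated v f) product_pmf p f
    <= expR (- 2 * A + 2 * S).
  move=> uv; pose D g := [disjoint edges (g : community n) & touching [set u; v]%SET (vertices g)].
  apply: (@le_trans _ _ (\sum_(f : {ffun 'I_m -> community n} | [forall i, D (f i)]) product_pmf p f)).
    apply: sum_product_pmf_le => // f /andP[/forallP fu /forallP fv] _.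
    apply/forallP => i; rewrite /D touchingU -finset.setI_eq0 finset.setIUr.
    by rewrite finset.setU_eq0 !finset.setI_eq0 fu fv.
  rewrite sum_product_pmf.
  have -> : - 2 * A + 2 * S = \sum_i (- (2 * (1 - delta) * alpha i) + 2 * gamma i).
    by rewrite big_split /= sumrN -!mulr_sumr /S /A; ring.
  rewrite expR_sum ler_prod // => i _; rewrite sumr_ge0 //=.
  by apply: le_trans (p2 i _ _ uv) _; rewrite -addrA expR_ge1Dx.
set P1 := \prod_i (1 - alpha i) in I1.
have P1_ge : expR (- A - 2 * S) <= P1.
  apply: (@le_trans _ _ (expR (\sum_i (- alpha i - 2 * alpha i ^+ 2)))).
    by rewrite ler_expR sumrB sumrN -mulr_sumr -/A; lra.
  rewrite expR_sum ler_prod // => i _.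
  by rewrite expR_ge0 expR_geB1.
have EN : \sum_f product_pmf p f * N f = n%:R * P1.
  under eq_bigr => f _ do rewrite mulr_sumr.
  rewrite exchange_big /= (eq_bigr (fun=> P1)) ?sumr_const ?card_ord ?mulr_natl //.
  by move=> u _; rewrite -(I1 u) [RHS]big_mkcond /=; apply: eq_bigr => f _; rewrite mulr_natr mulrb.
have EN2 : \sum_f product_pmf p f * N f ^+ 2 <= n%:R * P1 + n%:R ^+ 2 * expR (- 2 * A + 2 * S).
  have -> : \sum_f product_pmf p f * N f ^+ 2 =
      \sum_u \sum_v \sum_(f | isolated u f && isolated v f) product_pmf p f.
    under eq_bigr => f _ do rewrite expr2 mulr_suml mulr_sumr.
    rewrite exchange_big /=; apply: eq_bigr => u _.
    under eq_bigr => f _ do rewrite mulr_sumr mulr_sumr.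
    rewrite exchange_big /=; apply: eq_bigr => v _.
    rewrite [RHS]big_mkcond /=; apply: eq_bigr => f _.
    by rewrite -natrM mulnb mulr_natr mulrb.
  apply: (@le_trans _ _ (\sum_(u < n) (P1 + n%:R * expR (- 2 * A + 2 * S)))); last first.
    rewrite sumr_const card_ord -[leLHS]mulr_natl mulrDr expr2.
    by rewrite mulrA.
  (* The diagonal term v = u contributes [P1]; the others are bounded by [I2]. *)
  apply: ler_sum => u _; rewrite (bigD1 u) //= lerD //.
    by rewrite -(I1 u) le_eqVlt; apply/orP; left; apply/eqP/eq_bigl => f; rewrite andbb.
  apply: (@le_trans _ _ (\sum_(v < n | v != u) expR (- 2 * A + 2 * S))).
    by apply: ler_sum => v vu; apply: I2; rewrite eq_sym.
  rewrite sumr_const -[leLHS]mulr_natl ler_wpM2r ?expR_ge0 // ler_nat.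
  by rewrite -[n in (_ <= n)%N]card_ord max_card.
have P1_gt0 : 0 < P1 by apply: lt_le_trans P1_ge; apply: expR_gt0.
have mu0 : 0 < n%:R * P1 by rewrite mulr_gt0.
apply: (@le_trans _ _ (\sum_(f | N f == 0) product_pmf p f)).
  apply: sum_product_pmf_le => // f fc f0.
  rewrite /N psumr_eq0 //; apply/allP => u _; apply/implyP => _.
  rewrite pnatr_eq0 eqb0; apply/negP => /isolated_disconnected H.
  move: fc; apply/negP/H => // i.
  apply: contraNT f0 => fi.
  by rewrite /product_pmf (bigD1 i) //= p_supp // mul0r.
have := second_moment N w0 (sum_product_pmf1 p_sum1).
rewrite EN -ler_pdivlMr ?exprn_gt0 // => H; apply: le_trans H _.
rewrite mulrBl divff; last by rewrite gt_eqF // exprn_gt0.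
rewrite lerD2r ler_pdivrMr ?exprn_gt0 //; apply: le_trans EN2 _.
rewrite [leRHS]mulrDl lerD //.
  rewrite expr2 mulrA; apply: ler_peMl; first exact: ltW.
  apply: (@le_trans _ _ (expR (A - ln n%:R + 2 * S) * (n%:R * expR (- A - 2 * S)))).
    rewrite -{2}expL -!expRD.
    have -> : A - ln n%:R + 2 * S + (ln n%:R + (- A - 2 * S)) = 0 by ring.
    by rewrite expR0.
  by rewrite ler_wpM2l ?expR_ge0 // ler_wpM2l // ltW.
rewrite exprMn mulrCA ler_wpM2l ?exprn_ge0 //.
(* The exponents combine as -2 A + 2 S = 6 S + 2 (-A - 2 S). *)
apply: (@le_trans _ _ (expR (6 * S) * expR (- A - 2 * S) ^+ 2)).
  by rewrite expr2 -!expRD ler_expR; lra.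
by rewrite ler_wpM2l ?expR_ge0 // lerXn2r ?nnegrE ?expR_ge0 // ltW.
Qed.

(** The binomial coefficient in the hypothesis counts the sets of size k, so these contribute at
    most rho^k to the union bound, and the geometric series over k >= 1 is at most 2 rho for rho <=
    1/2. *)
Lemma prob_disconnected_le (rho : R) :
  0 <= rho <= 2^-1 ->
  (forall U : {set 'I_n}, (0 < #|U|)%N -> (#|U|.*2 <= n)%N ->
    'C(n, #|U|)%:R * \prod_i \sum_(g : community n |
      [disjoint edges g & crossing U (vertices g)]) p i g <= rho ^+ #|U|) ->
  \sum_(f | ~~ connected f) product_pmf p f <= 2 * rho.
Proof.
move=> /andP[r0 r1] Hr.
pose D (U : {set 'I_n}) (f : {ffun 'I_m -> community n}) :=
  [forall i, [disjoint edges (f i) & crossing U (vertices (f i))]].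
pose K (U : {set 'I_n}) := (0 < #|U|)%N && (#|U|.*2 <= n)%N.
apply: (@le_trans _ _ (\sum_(U | K U) \sum_(f | D U f) product_pmf p f)).
  under [leRHS]eq_bigr => U _ do rewrite big_mkcond.
  rewrite exchange_big /= [leLHS]big_mkcond /= ler_sum // => f _.
  have w0 : 0 <= product_pmf p f by apply: product_pmf_ge0.
  case: ifPn => [|_]; last by apply: sumr_ge0 => U _; case: ifP.
  move=> /disconnected_uncrossed[U [U0 Un DU]].
  rewrite (bigD1 U) /=; last by rewrite /K U0.
  rewrite ifT // lerDl.
  by apply: sumr_ge0 => V _; case: ifP.
apply: (@le_trans _ _ (\sum_(U | K U) rho ^+ #|U| / 'C(n, #|U|)%:R)).
  apply: ler_sum => U /andP[U0 Un].
  rewrite (sum_product_pmf p (fun g => [disjoint edges g & crossing U (vertices g)])).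
  rewrite ler_pdivlMr 1?mulrC ?Hr // ltr0n bin_gt0.
  by rewrite -[n in (_ <= n)%N]card_ord max_card.
apply: (@le_trans _ _ (\sum_(U : {set 'I_n} | (0 < #|U|)%N) rho ^+ #|U| / 'C(n, #|U|)%:R)).
  rewrite [leLHS]big_mkcond [leRHS]big_mkcond /= ler_sum // => U _.
  rewrite /K; case: (0 < #|U|)%N => //=; case: ifP => // _.
  by rewrite divr_ge0 ?exprn_ge0.
have cU (U : {set 'I_n}) : (#|U| < n.+1)%N.
  by rewrite ltnS -[n in (_ <= n)%N]card_ord max_card.
rewrite (partition_big (fun U : {set 'I_n} => Ordinal (cU U)) (fun k => 0 < k)%N) //=.
apply: (@le_trans _ _ (\sum_(k < n.+1 | (0 < k)%N) rho ^+ k)).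
  apply: ler_sum => k k0.
  rewrite (eq_bigr (fun=> rho ^+ k / 'C(n, k)%:R)); last by move=> U /andP[_ /eqP <-].
  rewrite (eq_bigl (fun U => U \in [set U : {set 'I_n} | #|U| == k]%SET)); last first.
    move=> U; rewrite finset.inE -(inj_eq val_inj) /=.
    by case: eqP => [->|]; rewrite ?k0 ?andbF.
  rewrite sumr_const card_draws card_ord -[leLHS]mulr_natr divfK //.
  by rewrite pnatr_eq0 -lt0n bin_gt0 -ltnS.
rewrite big_mkcond big_ord_recl /= add0r.
(* The factor [1 - rho ^+ j] strengthens the bound so that the induction goes through. *)
have G : forall j, \sum_(i < j) rho ^+ (bump 0 i) <= 2 * rho * (1 - rho ^+ j).
  elim=> [|j IHj]; first by rewrite big_ord0 expr0 subrr mulr0.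
  rewrite big_ord_recr /=; apply: le_trans (lerD IHj (lexx _)) _.
  rewrite /bump /= add1n !exprS.
  have : 0 <= rho ^+ j by rewrite exprn_ge0.
  set z := rho ^+ j => z0.
  have : 0 <= rho * z * (1 - 2 * rho) by rewrite !mulr_ge0 //; lra.
  lra.
apply: le_trans (G n) _; rewrite ler_piMr ?mulr_ge0 //.
by rewrite gerBl exprn_ge0.
Qed.

End bounds.

(** * The law of a community *)

Local Open Scope classical_set_scope.

(** As [nat] is discrete, {x} times a neighbourhood of q is a neighbourhood of (x, q). *)
Lemma continuous_nat_prod (R : realType) (f : nat * R -> R) :
  (forall x, continuous (fun q => f (x, q))) -> continuous f.
Proof.
move=> cf [x q] A /= /(cf x q) fA.
exists ([set x], (fun q' => f (x, q')) @^-1` A) => /=; first by split.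
by move=> [y q'] /= [-> ].
Qed.

Lemma measurable_nat_prod (R : realType) (f : nat * R -> R) :
  (forall x, measurable_fun setT (fun q => f (x, q))) -> measurable_fun setT f.
Proof.
move=> mf _ B mB; rewrite setTI.
rewrite (_ : _ @^-1` B =
    \bigcup_x ([set x] `*` ((fun q => f (x, q)) @^-1` B))); last first.
  apply/seteqP; split => [[x q] /= fB|[x q] [y _ [/= -> //]]].
  by exists x.
apply: bigcupT_measurable => x; apply: measurableX => //.
by rewrite -[X in measurable X]setTI; apply: mf.
Qed.

(* Test functions for convergence in distribution have to be bounded and
   continuous on all of nat * R, hence the clamping of the second argument. *)
Definition clamp (R : realType) (q : R) : R := Num.max 0 (Num.min q 1).

Lemma clamp_id (R : realType) (q : R) : 0 <= q <= 1 -> clamp q = q.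
Proof. by move=> /andP[q0 q1]; rewrite /clamp min_l // max_r. Qed.

Lemma clamp_itv (R : realType) (q : R) : 0 <= clamp q <= 1.
Proof. by rewrite /clamp le_max lexx ge_max ler01 ge_min lexx orbT. Qed.

Lemma continuous_clamp (R : realType) : continuous (@clamp R).
Proof.
move=> q; apply: (@continuous_max R R^o (cst 0) (fun q => Num.min q 1)).
  exact: cvg_cst.
by apply: (@continuous_min R R^o id (cst 1)); [exact: cvg_id|exact: cvg_cst].
Qed.

(** One functional for all the moments used: [c] will be 1, x, x ln(1 + x) or a truncation of
    these. *)
Definition weighted_h (R : realType) (c : nat -> R) (z : nat * R) : R :=
  c z.1 * hfun z.1 (clamp z.2).

Section weighted_h.
Context (R : realType) (c : nat -> R).

Lemma continuous_weighted_h_snd x : continuous (fun q => weighted_h c (x, q)).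
Proof.
move=> q; rewrite /weighted_h /=; apply: cvgM; first exact: cvg_cst.
rewrite /hfun; apply: cvgB; first exact: cvg_cst.
apply: (@continuous_comp _ _ _ (fun q : R => 1 - clamp q) (fun r => r ^+ x.-1)).
  by apply: cvgB; [exact: cvg_cst|exact: continuous_clamp].
exact: exprn_continuous.
Qed.

Lemma continuous_weighted_h : continuous (weighted_h c).
Proof. exact/continuous_nat_prod/continuous_weighted_h_snd. Qed.

Lemma measurable_weighted_h : measurable_fun setT (weighted_h c).
Proof.
apply: measurable_nat_prod => x.
apply: continuous_measurable_fun; exact: continuous_weighted_h_snd.
Qed.

Lemma weighted_h_ge0 z : (forall x, 0 <= c x) -> 0 <= weighted_h c z.
Proof.
by move=> c0; rewrite mulr_ge0 //; case/andP: (hfun_itv z.1 (clamp_itv z.2)).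
Qed.

Lemma weighted_hE x q : 0 <= q <= 1 -> weighted_h c (x, q) = c x * hfun x q.
Proof. by move=> q01; rewrite /weighted_h /= clamp_id. Qed.

Lemma weighted_h_bounded (M : R) : (forall x, `|c x| <= M) ->
  forall z, `|weighted_h c z| <= M.
Proof.
move=> cM z; rewrite normrM; have /andP[h0 h1] := hfun_itv z.1 (clamp_itv z.2).
by rewrite (ger0_norm h0) (le_trans _ (cM z.1)) // ler_piMr.
Qed.

End weighted_h.

(** * Decomposition of measures and integrals along a finite type *)

Section finite_index.
Context d (T : measurableType d) (R : realType).

Lemma measure_bigsetU_finType (mu : probability T R) (I : finType)
    (F : I -> set T) (D : pred I) :
  (forall i, measurable (F i)) -> trivIset setT F ->
  mu (\bigcup_(i in [set i | D i]) F i) = (\sum_(i | D i) mu (F i))%E.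
Proof.
move=> mF tF; set s := [seq i <- enum I | D i].
rewrite (_ : [set i | D i] = [set` s]); last first.
  by apply/seteqP; split => i /=; rewrite mem_filter mem_enum andbT.
rewrite -[LHS]mul1e -integral_cst; last first.
  by rewrite bigcup_seq; apply: bigsetU_measurable => i _.
rewrite bigcup_seq ge0_integral_bigsetU //.
- rewrite /s big_filter big_enum_cond /=; apply: eq_big => // i _.
  by rewrite integral_cst // mul1e.
- by rewrite filter_uniq // enum_uniq.
- by apply: sub_trivIset tF.
Qed.

Lemma ge0_integral_finType (mu : probability T R) (I : finType) (Y : T -> I)
    (f : T -> \bar R) :
  (forall i, measurable (Y @^-1` [set i])) -> measurable_fun setT f ->
  (forall x, (0 <= f x)%E) ->
  (\int[mu]_x f x = \sum_i \int[mu]_(x in Y @^-1` [set i]) f x)%E.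
Proof.
move=> mY mf f0.
have UT : \big[setU/set0]_(i <- index_enum I) (Y @^-1` [set i]) = setT.
  rewrite -bigcup_seq; apply/seteqP; split => // t _; exists (Y t) => //=.
  by rewrite mem_index_enum.
rewrite -UT ge0_integral_bigsetU //.
- by rewrite index_enum_uniq.
- by move=> i j _ _ [t [/= <- <-]].
- by rewrite UT.
Qed.

Lemma Rintegral_probability_cst (mu : probability T R) (a : R) :
  \int[mu]_x a = a.
Proof.
rewrite Rintegral_cst //; transitivity (a * fine (1%E : \bar R)); last exact: mulr1.
by congr (a * fine _); exact: probability_setT.
Qed.

(** This turns integration over the event that the random index is k into integration against a
    measure, whose pushforward independence then identifies. *)
Lemma integral_mrestr (mu : probability T R) (D : set T) (mD : measurable D)
    (f : T -> \bar R) : measurable_fun setT f -> (forall x, (0 <= f x)%E) ->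
  (\int[mrestr mu mD]_x f x = \int[mu]_(x in D) f x)%E.
Proof.
move=> mf f0; rewrite (@ge0_negligible_integral _ _ _ _ setT (~` D)) //.
- rewrite setTD setCK; apply: eq_measure_integral => A mA AD.
  by rewrite /= /mrestr setIidl.
- exact: measurableC.
- by rewrite /= /mrestr setICl measure0.
Qed.

End finite_index.

Lemma community_pmf_itv (R : realType) n x (q : R) (g : community n) :
  (x <= n)%N -> 0 <= q <= 1 -> 0 <= community_pmf x q g <= 1.
Proof.
move=> xn /andP[q0 q1]; rewrite /community_pmf; case: ifP => _; last by rewrite lexx ler01.
have C1 : 1 <= 'C(n, x)%:R :> R by rewrite ler1n bin_gt0.
have w (e : {set 'I_n}) : 0 <= (if e \in edges g then q else 1 - q) <= 1.
  by case: ifP => _; apply/andP; split; lra.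
apply/andP; split.
  by rewrite mulr_ge0 ?invr_ge0 // prodr_ge0 // => e _; case/andP: (w e).
rewrite mulr_ile1 ?invr_ge0 //.
- by rewrite prodr_ge0 // => e _; case/andP: (w e).
- by rewrite invf_le1 //; apply: lt_le_trans C1.
- by apply: prodr_ile1 => e _; exact: w.
Qed.

Lemma measurable_community_pmf (R : realType) n (g : community n) :
  measurable_fun setT (fun z : nat * R => community_pmf z.1 z.2 g).
Proof.
apply: measurable_nat_prod => x; rewrite /community_pmf /=.
have [_|_] := boolP (_ && _); last exact: measurable_cst.
apply: measurable_funM; first exact: measurable_cst.
under eq_fun => q do rewrite big_mkcond /=.
apply: measurable_prod => e _.
case: (e \in vpairs (vertices g)); last exact: measurable_cst.
by case: (e \in edges g) => //; apply: measurable_funB.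
Qed.

(** * Laws and moments of a community sequence *)

Section community_sequence.
Context (R : realType) (d : measure_display) (T : measurableType d)
  (P : probability T R) (n m : nat)
  (X : 'I_m -> {RV P >-> nat}) (Q : 'I_m -> {RV P >-> R})
  (G : 'I_m -> {RV P >-> community n}).
Hypothesis hG : is_community_sequence X Q G.

Let Xn i t : (X i t <= n)%N. Proof. by case: hG. Qed.
Let Q01 i t : 0 <= Q i t <= 1. Proof. by case: hG. Qed.

Definition community_law (i : 'I_m) (g : community n) : R :=
  fine (P (G i @^-1` [set g])).

(** Since [Q i] lies in [0, 1], the clamping has no effect and this is E(c(X_i) h(X_i, Q_i)). *)
Definition mean (i : 'I_m) (c : nat -> R) : R :=
  \int[P]_t weighted_h c (X i t, Q i t).

Let mXQ i : measurable_fun setT (fun t => (X i t, Q i t)).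
Proof. exact: measurable_fun_pair. Qed.

Let integrable_bounded i (f : nat * R -> R) (M : R) :
  measurable_fun setT f ->
  (forall x q, (x <= n)%N -> 0 <= q <= 1 -> `|f (x, q)| <= M) ->
  P.-integrable setT (EFin \o (fun t => f (X i t, Q i t))).
Proof.
move=> mf fM; apply: measurable_bounded_integrable => //.
- by rewrite (le_lt_trans (probability_le1 _ _)) // ltry.
- exact: measurableT_comp.
- exists M; split; first exact: num_real.
  by move=> M' MM' t _ /=; apply: le_trans (ltW MM'); apply: fM.
Qed.

(** Any weight is allowed: as X_i <= n, only finitely many values of [c] occur. *)
Let integrable_weighted_h i c :
  P.-integrable setT (EFin \o (fun t => weighted_h c (X i t, Q i t))).
Proof.
apply: (@integrable_bounded _ _ (\sum_(x < n.+1) `|c x|)).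
  exact: measurable_weighted_h.
move=> x q xn q01; rewrite weighted_hE // normrM.
have /andP[h0 h1] := hfun_itv x q01; rewrite (ger0_norm h0).
apply: (@le_trans _ _ `|c x|); first by rewrite ler_piMr.
rewrite (bigD1 (Ordinal (xn : (x < n.+1)%N))) //= lerDl.
by rewrite sumr_ge0.
Qed.

Let integrable_pmf i (g : community n) :
  P.-integrable setT (EFin \o (fun t => community_pmf (X i t) (Q i t) g)).
Proof.
apply: (@integrable_bounded _ (fun z => community_pmf z.1 z.2 g) 1).
  exact: measurable_community_pmf.
by move=> x q xn q01; have /andP[p0 p1] := community_pmf_itv g xn q01; rewrite ger0_norm.
Qed.

Let pmf_ge0 i t (g : community n) : 0 <= community_pmf (X i t) (Q i t) g.
Proof. by case/andP: (community_pmf_itv g (Xn i t) (Q01 i t)). Qed.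

Let mX i (x : nat) : measurable (X i @^-1` [set x]).
Proof. by apply: measurable_funPTI. Qed.

Let mG i (A : set (community n)) : measurable (G i @^-1` A).
Proof. exact: measurable_funPTI. Qed.

Lemma community_lawEFin i g : (community_law i g)%:E = P (G i @^-1` [set g]).
Proof. by rewrite fineK // fin_num_measure. Qed.

(** Total probability: the conditional law clause, with [B] the whole line, is summed over the
    finitely many values of X_i. *)
Lemma community_lawE i g :
  (community_law i g)%:E = (\int[P]_t (community_pmf (X i t) (Q i t) g)%:E)%E.
Proof.
rewrite community_lawEFin.
pose Y t := Ordinal (Xn i t : (X i t < n.+1)%N).
have YX k : Y @^-1` [set k] = X i @^-1` [set (k : nat)].
  apply/seteqP; split => t /=; first by move=> <-.
  by move=> Xk; apply: val_inj.
have mpmf := measurable_int _ (integrable_pmf i g).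
have mY k : measurable (Y @^-1` [set k]) by rewrite YX.
rewrite (ge0_integral_finType P mY mpmf); last first.
  by move=> t; rewrite lee_fin.
have -> : G i @^-1` [set g] = \bigcup_(k in [set k : 'I_n.+1 | true])
    ((X i @^-1` [set (k : nat)]) `&` (G i @^-1` [set g])).
  apply/seteqP; split => [t Gt|t [k _ []] //]; by exists (Y t).
rewrite measure_bigsetU_finType; first last.
- by move=> k l _ _ [t [[/= Xk _] [/= Xl _]]]; apply: val_inj; rewrite /= -Xk.
- by move=> k; apply: measurableI.
apply: eq_bigr => k _.
have [_ _ _ /(_ i k setT g measurableT) H] := hG.
rewrite YX (_ : _ `&` _ = [set t | [/\ X i t = k, setT (Q i t) & G i t = g]]).
  rewrite H (_ : [set t | _] = X i @^-1` [set (k : nat)]).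
    by apply: eq_integral => t; rewrite inE /= => ->.
  by apply/seteqP; split => t /=; [case|].
by apply/seteqP; split => t /=; [move=> [-> ->]|move=> [-> _ ->]].
Qed.

Lemma community_law_ge0 i g : 0 <= community_law i g.
Proof. exact: fine_ge0. Qed.

Lemma sum_community_law i (D : pred (community n)) :
  \sum_(g | D g) community_law i g =
  \int[P]_t (\sum_(g | D g) community_pmf (X i t) (Q i t) g).
Proof.
rewrite /Rintegral; under eq_integral => t _ do rewrite -sumEFin.
rewrite integral_sum //; last by move=> g; apply: integrable_pmf.
rewrite (eq_bigr (fun g => (community_law i g)%:E)); last first.
  by move=> g _; rewrite community_lawE.
by rewrite sumEFin.
Qed.

Lemma sum_community_law1 i : \sum_g community_law i g = 1.
Proof.
apply: EFin_inj; rewrite -sumEFin.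
under eq_bigr => g _ do rewrite community_lawEFin.
have tG : trivIset setT (fun g => G i @^-1` [set g]).
  by move=> g g' _ _ [t [/= <- <-]].
rewrite -(measure_bigsetU_finType P xpredT (fun g => mG i [set g]) tG).
rewrite (_ : \bigcup_(g in _) _ = setT) ?probability_setT //.
by apply/seteqP; split => // t _; exists (G i t).
Qed.

Lemma community_law_supp i g :
  ~~ (edges g \subset vpairs (vertices g)) -> community_law i g = 0.
Proof.
move=> gV; apply: EFin_inj; rewrite community_lawE (eq_integral (cst 0%E)).
  by rewrite integral0.
by move=> t _; rewrite /community_pmf (negPf gV) andbF.
Qed.

Let integrable_affine i (u v : R) c c' :
  P.-integrable setT (EFin \o (fun t => 1 - u * weighted_h c (X i t, Q i t)
    + v * weighted_h c' (X i t, Q i t))).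
Proof.
apply: (@integrableD _ _ _ P setT _
  (EFin \o (fun t => 1 - u * weighted_h c (X i t, Q i t)))
  (EFin \o (fun t => v * weighted_h c' (X i t, Q i t)))) => //.
  apply: (@integrableB _ _ _ P setT _ (cst 1%E)
    (EFin \o (fun t => u * weighted_h c (X i t, Q i t)))) => //.
    exact: finite_measure_integrable_cst.
  exact: (integrableZl measurableT u (integrable_weighted_h i c)).
exact: (integrableZl measurableT v (integrable_weighted_h i c')).
Qed.

Let mean_affine i (u v : R) c c' :
  \int[P]_t (1 - u * weighted_h c (X i t, Q i t) + v * weighted_h c' (X i t, Q i t))
  = 1 - u * mean i c + v * mean i c'.
Proof.
have I1 := finite_measure_integrable_cst P (1 : R) measurableT.
have I2 := integrableZl measurableT u (integrable_weighted_h i c).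
have I3 := integrableZl measurableT v (integrable_weighted_h i c').
have I12 := integrableB measurableT I1 I2.
rewrite (RintegralD measurableT I12 I3) (RintegralB measurableT I1 I2).
by rewrite !RintegralZl // Rintegral_probability_cst.
Qed.

(** Carries a conditional bound given (X_i, Q_i) = (x, q) over to the law of the community; the
    second weight leaves room for a truncation term. *)
Lemma sum_community_law_le i (D : pred (community n)) (u v : R) c c' :
  (forall x q, (x <= n)%N -> 0 <= q <= 1 ->
    \sum_(g | D g) community_pmf x q g <=
    1 - u * (c x * hfun x q) + v * (c' x * hfun x q)) ->
  \sum_(g | D g) community_law i g <= 1 - u * mean i c + v * mean i c'.
Proof.
move=> H; rewrite sum_community_law -mean_affine; apply: le_Rintegral => //.
- rewrite (_ : _ \o _ = fun t => (\sum_(g | D g) (community_pmf (X i t) (Q i t) g)%:E)%E).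
    by apply: integrable_sum => // g _; apply: integrable_pmf.
  by apply/funext => t /=; rewrite sumEFin.
- by move=> t _; rewrite !weighted_hE //; apply: H.
Qed.

Lemma sum_community_law_eq i (D : pred (community n)) (u : R) c :
  (forall x q, (x <= n)%N -> 0 <= q <= 1 ->
    \sum_(g | D g) community_pmf x q g = 1 - u * (c x * hfun x q)) ->
  \sum_(g | D g) community_law i g = 1 - u * mean i c.
Proof.
move=> H; rewrite sum_community_law.
have := mean_affine i u 0 c c; rewrite mul0r addr0 => <-.
by apply: eq_Rintegral => t _; rewrite mul0r addr0 !weighted_hE //; apply: H.
Qed.

Lemma mean_ge0 i c : (forall x, 0 <= c x) -> 0 <= mean i c.
Proof. by move=> c0; apply: Rintegral_ge0 => t _; apply: weighted_h_ge0. Qed.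

Lemma mean_le_affine i c c' (a b : R) :
  (forall x q, (x <= n)%N -> 0 <= q <= 1 ->
     c x * hfun x q <= a + b * (c' x * hfun x q)) ->
  mean i c <= a + b * mean i c'.
Proof.
move=> H.
have I1 := finite_measure_integrable_cst P a measurableT.
have I2 := integrableZl measurableT b (integrable_weighted_h i c').
apply: (@le_trans _ _ (\int[P]_t (a + b * weighted_h c' (X i t, Q i t)))).
  apply: le_Rintegral => //; first exact: (integrableD measurableT I1 I2).
  by move=> t _; rewrite !weighted_hE //; apply: H.
rewrite (RintegralD measurableT I1 I2).
by rewrite !RintegralZl // Rintegral_probability_cst.
Qed.

Lemma meanD i c c' : mean i (fun x => c x + c' x) = mean i c + mean i c'.
Proof.
rewrite -(RintegralD measurableT (integrable_weighted_h i c) (integrable_weighted_h i c')).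
by apply: eq_Rintegral => t _; rewrite /weighted_h mulrDl.
Qed.

Lemma mean_EFin i c : (forall x, 0 <= c x) ->
  (mean i c)%:E = (\int[P]_t (weighted_h c (X i t, Q i t))%:E)%E.
Proof.
by move=> c0; rewrite fineK //; apply: integrable_fin_num => //; apply: integrable_weighted_h.
Qed.

(** The event splits into the finitely many configurations [f] of all communities. Independence,
    applied to rectangles that leave (X_i, Q_i) free, makes each of them a product. *)
Lemma prob_affiliation (D : pred {set {set 'I_n}}) :
  P [set t | D (affiliation_edges (fun i => G i t))] =
  (\sum_(f : {ffun 'I_m -> community n} | D (affiliation_edges f))
     product_pmf community_law f)%:E.
Proof.
pose E (f : {ffun 'I_m -> community n}) := \bigcap_i (G i @^-1` [set f i]).
have -> : [set t | D (affiliation_edges (fun i => G i t))] =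
    \bigcup_(f in [set f : {ffun 'I_m -> community n} | D (affiliation_edges f)]) E f.
  apply/seteqP; split => t /=.
    move=> Dt; exists [ffun i => G i t]; last by move=> i _ /=; rewrite ffunE.
    rewrite /= (_ : affiliation_edges _ = affiliation_edges (fun i => G i t)) //.
    by apply: eq_bigr => i _; rewrite ffunE.
  move=> [f /= Df Et].
  rewrite (_ : affiliation_edges _ = affiliation_edges f) //.
  by apply: eq_bigr => i _; rewrite (Et i I).
rewrite measure_bigsetU_finType -?sumEFin; first last.
- move=> f f' _ _ [t [Ef Ef']]; apply/ffunP => i.
  by rewrite -(Ef i I) -(Ef' i I).
- by move=> f; apply: fin_bigcap_measurable.
apply: eq_bigr => f _; rewrite /product_pmf -prodEFin.
have [_ _ ind _] := hG.
have := ind [set: 'I_m]%SET (fun i => setT `*` [set f i]).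
have -> : \bigcap_(i in [set i | i \in [set: 'I_m]%SET])
    (fun t => (X i t, Q i t, G i t)) @^-1` (setT `*` [set f i]) = E f.
  apply/seteqP; split => t /= H i; first by have [] := H i; rewrite /= ?finset.in_setT.
  by move=> _; split => //=; apply: H.
move=> ->; last by move=> i _; apply: measurableX.
apply: eq_big => [i|i _]; first by rewrite finset.in_setT.
rewrite community_lawEFin; congr (P _).
by apply/seteqP; split => t /=; [case|].
Qed.

(** On the event that the index is k the integrand depends on (X_k, Q_k) only, so the integral is
    split along the values of [istar]. *)
Lemma expectation_uniform_index (istar : T -> 'I_m) (c : nat -> R) :
  is_uniform_index X Q istar -> (forall x, 0 <= c x) ->
  ('E_P[fun t => (c (X (istar t) t) * hfun (X (istar t) t) (Q (istar t) t))%R] =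
   (m%:R^-1 * \sum_i mean i c)%R%:E)%E.
Proof.
move=> [mI PI ind] c0; rewrite unlock.
under eq_integral => t _ do rewrite -weighted_hE //.
have m0 (k : 'I_m) : measurable_fun setT (fun t => (weighted_h c (X k t, Q k t))%:E).
  exact: measurable_int _ (integrable_weighted_h k c).
have ms : measurable_fun setT (fun t => (weighted_h c (X (istar t) t, Q (istar t) t))%:E).
  move=> _ B mB; rewrite setTI.
  rewrite (_ : _ @^-1` B = \bigcup_(k in [set k : 'I_m | true]) (istar @^-1` [set k] `&`
     (fun t => (weighted_h c (X k t, Q k t))%:E) @^-1` B)).
    apply: fin_bigcup_measurable => // k _; apply: measurableI => //.
    by rewrite -[X in measurable X]setTI; apply: m0.
  apply/seteqP; split => t /=; first by move=> Bt; exists (istar t).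
  by move=> [k _ [/= <-]].
rewrite (ge0_integral_finType P mI ms); last first.
  by move=> t; rewrite lee_fin weighted_h_ge0.
rewrite mulr_sumr -sumEFin; apply: eq_bigr => k _.
transitivity (\int[P]_(t in istar @^-1` [set k]) (weighted_h c (X k t, Q k t))%:E)%E.
  by apply: eq_integral => t; rewrite inE /= => ->.
have w0 z : (0 <= (weighted_h c z)%:E)%E by rewrite lee_fin weighted_h_ge0.
rewrite -(integral_mrestr P (mI k)) //.
have mw : measurable_fun setT (fun z : nat * R => (weighted_h c z)%:E).
  by apply/measurable_EFinP; exact: measurable_weighted_h.
rewrite -(@ge0_integral_pushforward _ _ _ _ _ _ (mXQ k) _ setT (fun z => (weighted_h c z)%:E)) //.
have im : 0 <= (m%:R^-1 : R) by rewrite invr_ge0.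
(* By independence, P restricted to [istar = k] and pushed forward along (X_k, Q_k) is 1/m times the
   law of (X_k, Q_k). The rectangle used has [A] as its k-th side and is unrestricted elsewhere. *)
rewrite (eq_measure_integral (mscale (NngNum im) (pushforward P (fun t => (X k t, Q k t))))).
  rewrite ge0_integral_mscale //= EFinM mean_EFin //; congr (_ * _)%E.
  by rewrite ge0_integral_pushforward.
move=> A mA _; rewrite /= /pushforward /mrestr /mscale /=.
have := ind k (fun i => if i == k then A else setT).
rewrite PI (_ : \bigcap_i _ = (fun t => (X k t, Q k t)) @^-1` A).
  rewrite setIC; apply => i.
  by case: ifP.
apply/seteqP; split => t /=; first by move=> /(_ k I) /=; rewrite eqxx.
by move=> At i _ /=; case: eqP => [->|].
Qed.

End community_sequence.

(** * Bounds for fixed n *)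

(** C(n, k) <= n^k / k!, where k^k / k! <= e^k as a term of the exponential series, and n <= k e^g
    by hypothesis. *)
Lemma bin_le_expR (R : realType) n k (g : R) : (0 < k)%N ->
  expR (ln n%:R - g) <= k%:R -> (0 < n)%N ->
  'C(n, k)%:R <= expR (k%:R * (1 + g)).
Proof.
move=> k0 kg n0; have n0' : 0 < n%:R :> R by rewrite ltr0n.
have k0' : 0 < k%:R :> R by rewrite ltr0n.
have f0 : 0 < k`!%:R :> R by rewrite ltr0n fact_gt0.
have H1 : 'C(n, k)%:R * k`!%:R <= n%:R ^+ k :> R.
  rewrite -natrM bin_ffact -natrX ler_nat.
  elim: (k) => [|j IHj]; first by rewrite ffactn0.
  by rewrite ffactnSr expnSr leq_mul // leq_subr.
have H2 : k%:R ^+ k / k`!%:R <= expR k%:R :> R.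
  case: k k0 k0' {kg f0 H1} => // k _ k0'.
  by apply: le_trans (expR_ge1Dxn k (ltW k0')); rewrite lerDr.
have H3 : n%:R ^+ k <= k%:R ^+ k * expR (k%:R * g) :> R.
  rewrite expRM_natl -exprMn lerXn2r ?nnegrE ?mulr_ge0 ?expR_ge0 //.
  rewrite -[leLHS]lnK ?posrE // -[X in expR X](subrK g) expRD.
  by rewrite ler_wpM2r ?expR_ge0.
rewrite -(ler_pM2r f0); apply: le_trans H1 (le_trans H3 _).
rewrite mulrDr mulr1 expRD mulrAC ler_wpM2r ?expR_ge0 //.
by rewrite -ler_pdivrMr.
Qed.

Lemma bin_le_exprn (R : realType) n k : 'C(n, k)%:R <= n%:R ^+ k :> R.
Proof.
apply: (@le_trans _ _ ('C(n, k)%:R * k`!%:R)).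
  by rewrite ler_peMr // ler1n fact_gt0.
rewrite -natrM bin_ffact -natrX ler_nat.
elim: (k) => [|j IHj]; first by rewrite ffactn0.
by rewrite ffactnSr expnSr leq_mul // leq_subr.
Qed.

Section connectivity_bounds.
Context (R : realType) (d : measure_display) (T : measurableType d)
  (P : probability T R) (n m : nat)
  (X : 'I_m -> {RV P >-> nat}) (Q : 'I_m -> {RV P >-> R})
  (G : 'I_m -> {RV P >-> community n}).
Hypothesis hG : is_community_sequence X Q G.
Hypothesis n_gt1 : (1 < n)%N.
Hypothesis m_gt0 : (0 < m)%N.

Definition tail_weight (b : R) (x : nat) : R := x%:R * (b < x%:R)%R%:R.

(** By [expectation_uniform_index] this is a moment of the pair at the uniform index; c(x) = x gives
    kappa_n. *)
Definition average (c : nat -> R) : R := m%:R^-1 * \sum_i mean X Q i c.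

Let L : R := ln n%:R.
Let kappa := average (fun x => x%:R).
Let lambda := L - m%:R / n%:R * kappa.

Let n0 : 0 < n%:R :> R. Proof. by rewrite ltr0n ltnW. Qed.
Let m0 : 0 < m%:R :> R. Proof. by rewrite ltr0n. Qed.
Let expL : expR L = n%:R. Proof. by rewrite lnK // posrE. Qed.

Let sum_mean c : \sum_i mean X Q i c = m%:R * average c.
Proof. by rewrite /average mulVKf // gt_eqF. Qed.

Let tail_weight_ge0 b x : 0 <= tail_weight b x.
Proof. by rewrite mulr_ge0. Qed.

Lemma average_ge0 c : (forall x, 0 <= c x) -> 0 <= average c.
Proof.
by move=> c0; rewrite mulr_ge0 ?invr_ge0 // sumr_ge0 // => i _; apply: mean_ge0.
Qed.

Lemma averageD c c' :
  average (fun x => c x + c' x) = average c + average c'.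
Proof.
rewrite /average -mulrDr -big_split; congr (_ * _).
by apply: eq_bigr => i _; apply: (meanD hG).
Qed.

Lemma ler_average c c' (b : R) :
  (forall x q, 0 <= q <= 1 -> c x * hfun x q <= b * (c' x * hfun x q)) ->
  average c <= b * average c'.
Proof.
move=> H; rewrite mulrCA ler_wpM2l ?invr_ge0 // mulr_sumr ler_sum // => i _.
rewrite -[leRHS]add0r; apply: (mean_le_affine hG) => x q _ q01.
by rewrite add0r; apply: H.
Qed.

Lemma connected_prob_le1 :
  (P [set t | connected_graph (affiliation_edges (fun i => G i t))] <= 1)%E.
Proof.
rewrite (prob_affiliation hG) lee_fin.
have p0 i g : 0 <= community_law G i g by apply: community_law_ge0.
have p1 i : \sum_g community_law G i g = 1 by apply: sum_community_law1.
rewrite -[leRHS](sum_product_pmf1 p1) [leRHS](bigID (fun f : {ffun 'I_m -> community n} =>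
  connected_graph (affiliation_edges f))) /= lerDl.
by apply: sumr_ge0 => f _; apply: product_pmf_ge0.
Qed.

(** [prob_connected_le] with delta = n^(-1/2), so that communities count as large beyond delta n =
    n^(1/2); [s] dominates its error term. *)
Lemma connected_prob_le (k0 : R) :
  let chi := average (tail_weight (expR (L / 2))) in
  let s := L * expR (- L / 2) + L * chi / k0 in
  0 < k0 -> k0 <= kappa -> 0 <= lambda -> 1 <= L -> s <= 2^-1 ->
  (P [set t | connected_graph (affiliation_edges (fun i => G i t))] <=
   (expR (- lambda + 2 * s) + expR (6 * s) - 1)%:E)%E.
Proof.
move=> chi s k00 kk la0 L1 s2; rewrite (prob_affiliation hG) lee_fin.
pose delta := expR (- L / 2).
have dn : delta * n%:R = expR (L / 2).
  by rewrite -expL -expRD; congr expR; field.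
pose alpha i := mean X Q i (fun x => x%:R) / n%:R.
pose gamma i := mean X Q i (tail_weight (delta * n%:R)) / n%:R.
have d0 : 0 <= delta by apply: expR_ge0.
have g0 i : 0 <= gamma i by rewrite divr_ge0 ?mean_ge0 ?ltW // => x.
have chi0 : 0 <= chi by rewrite average_ge0.
have sA : \sum_i alpha i = L - lambda.
  by rewrite -mulr_suml sum_mean -/kappa /lambda; ring.
have sG : \sum_i gamma i = m%:R / n%:R * chi.
  by rewrite -mulr_suml sum_mean dn -/chi; ring.
have AL : \sum_i alpha i <= L by rewrite sA gerBl.
have A0 : 0 <= \sum_i alpha i.
  by apply: sumr_ge0 => i _; rewrite divr_ge0 ?mean_ge0 ?ltW.
(* Here (m / n) kappa = L - lambda <= L, hence m / n <= L / k0. *)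
have GL : \sum_i gamma i <= L * chi / k0.
  rewrite sG [leRHS]mulrAC ler_wpM2r // ler_pdivlMr //.
  apply: le_trans AL; rewrite sA /lambda opprB addrCA subrr addr0.
  by rewrite ler_wpM2l // divr_ge0 ?ltW.
have sS : delta * \sum_i alpha i + \sum_i gamma i <= s.
  by rewrite lerD // mulrC ler_wpM2r.
apply: le_trans (prob_connected_le (p := community_law G) (alpha := alpha)
  (gamma := gamma) (delta := delta) _ _ _ _ _ _ _ _ _ _) _ => //.
- by move=> i g; apply: community_law_ge0.
- by move=> i; apply: sum_community_law1.
- exact: (community_law_supp hG).
(* Since L >= 1, delta is at most the first summand L delta of [s]. *)
- apply: le_trans s2; rewrite lerD //.
  by rewrite ler_peMl.
- move=> i; apply/andP; split; first by rewrite divr_ge0 ?mean_ge0 ?ltW.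
  rewrite /alpha /gamma ler_pdivrMr // mulrDl divfK ?gt_eqF //.
  have := @mean_le_affine _ _ _ P n m X Q G hG i (fun x => x%:R)
    (tail_weight (delta * n%:R)) (delta * n%:R) 1.
  rewrite mul1r; apply => x q xn q01.
  have /andP[h0 h1] := hfun_itv x q01; rewrite mul1r /tail_weight.
  case: ltP => H; rewrite ?mulr1 ?mulr0 ?mul0r ?addr0.
    by rewrite lerDr dn expR_ge0.
  by apply: le_trans H; rewrite ler_piMr.
- move=> i u; rewrite (sum_community_law_eq hG i (u := n%:R^-1) (c := fun x => x%:R)).
    by rewrite /alpha mulrC.
  by move=> x q xn q01; rewrite sum_pmf_isolated // mulrC [n%:R^-1 * _]mulrC.
- move=> i u v uv.
  apply: le_trans (sum_community_law_le hG i (u := 2 / n%:R * (1 - delta))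
    (v := 2 / n%:R) (c := fun x => x%:R) (c' := tail_weight (delta * n%:R)) _) _.
    move=> x q xn q01; rewrite /tail_weight [X in _ + _ * X]mulrAC.
    exact: sum_pmf_isolated2.
  rewrite le_eqVlt; apply/orP; left; apply/eqP; rewrite /alpha /gamma.
  by field; rewrite gt_eqF.
rewrite lerD2r lerD // ler_expR; last by rewrite ler_wpM2l.
by move: sS; rewrite sA -/L; lra.
Qed.

(** Each of the two ranges of k = |U|, separated at n^(1 - gamma), is bounded by the k-th power of
    one summand of [rho]; [theta] is the relative loss in the sharp bound. *)
Lemma connected_prob_ge (k0 k1 gamma : R) :
  let chi := average (tail_weight (expR (gamma * L / 2))) in
  let theta := expR (- gamma * L / 2) + chi / k0 in
  let rho := expR (lambda / 2 + 1) + expR (1 - gamma * L) in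
  0 < gamma -> 0 < k0 -> k0 <= kappa -> kappa <= k1 ->
  2 * gamma * k1 <= average (fun=> 1) ->
  0 <= L -> lambda <= 0 -> theta <= 2^-1 -> theta * L <= 1 -> rho <= 2^-1 ->
  ((1 - 2 * rho)%:E <=
   P [set t | connected_graph (affiliation_edges (fun i => G i t))])%E.
Proof.
move=> chi theta rho g0 k00 k0k kk1 ge L0 la0 th thL rho1.
rewrite (prob_affiliation hG) lee_fin.
have p0 i g : 0 <= community_law G i g by apply: community_law_ge0.
have p1 i : \sum_g community_law G i g = 1 by apply: sum_community_law1.
have := sum_product_pmf1 p1.
rewrite (bigID (fun f : {ffun 'I_m -> community n} =>
  connected_graph (affiliation_edges f))) /= => E.
rewrite lerBlDr -{1}E lerD2l.
apply: prob_disconnected_le => //.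
  by rewrite addr_ge0 ?expR_ge0.
move=> U U0 Un; set k := #|U| in U0 Un *.
have k0' : 0 < k%:R :> R by rewrite ltr0n.
have kap0 : 0 < kappa by apply: lt_le_trans k0k.
have mnE : m%:R / n%:R * kappa = L - lambda by rewrite /lambda; ring.
have chi0 : 0 <= chi by rewrite average_ge0.
have p_ge0 : 0 <= k%:R / n%:R :> R by rewrite divr_ge0 // ltW.
have rho0 : 0 <= rho by rewrite addr_ge0 ?expR_ge0.
have prod_le (b : 'I_m -> R) (B : R) :
    (forall i, \sum_(g : community n | [disjoint edges g & crossing U (vertices g)])
       community_law G i g <= 1 - b i) ->
    'C(n, k)%:R <= expR B ->
  'C(n, k)%:R * \prod_i \sum_(g : community n | [disjoint edges g & crossing U (vertices g)])
       community_law G i g <= expR (B - \sum_i b i).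
  move=> Hb HB; rewrite expRD ler_pM //.
    by apply: prodr_ge0 => i _; apply: sumr_ge0.
  rewrite -sumrN expR_sum ler_prod // => i _; rewrite sumr_ge0 //=.
  exact: le_trans (Hb i) (expR_ge1Dx _).
(* For large k, C(n, k) <= exp(k (1 + gamma L)), while the crude bound yields the exponent k (m / n)
   E h >= 2 gamma L k, because (m / n) kappa >= L and kappa <= k1. *)
have [kg|kg] := ltP (expR (L - gamma * L)) k%:R.
  apply: (@le_trans _ _ (expR (k%:R * (1 - gamma * L)))); last first.
    by rewrite expRM_natl lerXn2r ?nnegrE ?expR_ge0 // lerDr expR_ge0.
  apply: le_trans (prod_le (fun i => k%:R / n%:R * mean X Q i (fun=> 1))
     (k%:R * (1 + gamma * L)) _ _) _.
  - move=> i.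
    rewrite -[leRHS]addr0 -[X in _ <= _ + X](mul0r (mean X Q i (fun=> 1))).
    apply: (sum_community_law_le hG i) => x q xn q01; rewrite mul0r addr0 mul1r.
    by apply: sum_pmf_uncrossed_card => //; apply: ltnW.
  - by apply: bin_le_expR => //; [exact: ltW|exact: ltnW].
  rewrite ler_expR -mulr_sumr sum_mean.
  have H1 : 2 * gamma * L <= m%:R / n%:R * average (fun=> 1).
    apply: (@le_trans _ _ (m%:R / n%:R * (2 * gamma * k1))); last first.
      by rewrite ler_wpM2l // divr_ge0 // ltW.
    have g2 : 0 <= 2 * gamma by rewrite mulr_ge0 // ltW.
    apply: (@le_trans _ _ (2 * gamma * (m%:R / n%:R * kappa))).
      by rewrite mnE ler_wpM2l //; lra.
    rewrite mulrCA ler_wpM2l //.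
    exact: ler_wpM2l.
  have -> : k%:R / n%:R * (m%:R * average (fun=> 1)) = k%:R * (m%:R / n%:R * average (fun=> 1)) by ring.
  rewrite -mulrBr ler_wpM2l //; lra.
(* For small k, truncating at b = n^(gamma / 2) keeps b k / n <= n^(-gamma / 2). *)
pose b := expR (gamma * L / 2).
have bp : b * (k%:R / n%:R) <= expR (- gamma * L / 2).
  apply: (@le_trans _ _ (b * (expR (L - gamma * L) / n%:R))).
    by rewrite ler_wpM2l ?expR_ge0 // ler_wpM2r // invr_ge0 ltW.
  rewrite -expL -expRN -!expRD ler_expR.
  by rewrite le_eqVlt; apply/orP; left; apply/eqP; field.
have bp1 : b * (k%:R / n%:R) <= 1.
  apply: le_trans bp _; rewrite -[leRHS]expR0 ler_expR.
  by rewrite mulNr mulNr oppr_le0 !mulr_ge0 // ltW.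
apply: (@le_trans _ _ (expR (k%:R * (lambda / 2 + 1)))); last first.
  by rewrite expRM_natl lerXn2r ?nnegrE ?expR_ge0 // lerDl expR_ge0.
pose u := k%:R / n%:R * (1 - b * (k%:R / n%:R)).
apply: le_trans (prod_le (fun i => u * mean X Q i (fun x => x%:R)
   - u * mean X Q i (tail_weight b)) (k%:R * L) _ _) _.
- move=> i; rewrite opprB addrA addrAC.
  apply: (sum_community_law_le hG i) => x q xn q01.
  rewrite /tail_weight [X in _ + _ * X]mulrAC -addrA -mulrN -mulrDr.
  rewrite (_ : - (x%:R * hfun x q) = 0 - x%:R * hfun x q) ?sub0r //.
  have := sum_pmf_uncrossed_trunc (ltnW n_gt1) xn q01 bp1; rewrite -/u.
  by rewrite mulrBr opprB; rewrite mulrBr; lra.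
- by rewrite expRM_natl expL bin_le_exprn.
rewrite ler_expR sumrB -!mulr_sumr !sum_mean -/kappa -/chi.
have -> : u * (m%:R * kappa) - u * (m%:R * chi) =
   k%:R * ((1 - b * (k%:R / n%:R)) * (m%:R / n%:R * kappa - m%:R / n%:R * chi)).
  by rewrite /u; ring.
rewrite -mulrBr ler_wpM2l //.
have mchi : m%:R / n%:R * chi <= (L - lambda) * (chi / k0).
  rewrite -mnE -[leRHS]mulrA ler_wpM2l // mulrCA ler_peMr //.
  by rewrite ler_pdivlMr // mul1r.
have A0 : 0 <= L - lambda by rewrite subr_ge0 (le_trans la0).
rewrite mnE.
set y := b * _ in bp bp1 *; set z := chi / k0 in mchi theta th thL *.
have z0 : 0 <= z by rewrite divr_ge0 // ltW.
have y0 : 0 <= y by rewrite mulr_ge0 ?expR_ge0.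
have H : (1 - y) * ((L - lambda) * (1 - z)) <= (1 - y) * (L - lambda - m%:R / n%:R * chi).
  by rewrite ler_wpM2l ?subr_ge0 //; lra.
have H2 : (L - lambda) * (1 - theta) <= (1 - y) * ((L - lambda) * (1 - z)).
  rewrite [leRHS]mulrCA ler_wpM2l //.
  have : 0 <= y * z by rewrite mulr_ge0.
  by move: bp; rewrite /theta; lra.
have H3 : lambda * (1 - theta) <= lambda * 2^-1.
  by rewrite ler_wnM2l //; lra.
by move: H H2 H3 thL; lra.
Qed.

End connectivity_bounds.

(** * Asymptotics *)

Section log_limits.
Context (R : realType).

Lemma cvg_EFin_fine (f : nat -> R) (l : R) :
  (f n)%:E @[n --> \oo] --> l%:E -> f n @[n --> \oo] --> l.
Proof. by move/fine_cvg. Qed.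

Lemma near_ge_ln (A : R) : \forall n \near \oo, A <= ln n%:R.
Proof.
near=> n; have An : expR A <= n%:R by near: n; exact: nbhs_infty_ger.
by rewrite -[A]expRK ler_ln // ?posrE ?expR_gt0 //; apply: lt_le_trans An; apply: expR_gt0.
Unshelve. all: by end_near. Qed.

(** From exp(y) >= y^2 / 2 with y = gamma L, the left-hand side is at most 2 / (gamma^2 L). *)
Lemma near_ln_expR (gamma epsilon : R) : 0 < gamma -> 0 < epsilon ->
  \forall n \near \oo, ln n%:R * expR (- gamma * ln n%:R) <= epsilon :> R.
Proof.
move=> g0 e0; near=> n.
have L1 : 1 <= ln n%:R :> R by near: n; exact: near_ge_ln.
have L2 : 2 / (gamma ^+ 2 * epsilon) <= ln n%:R by near: n; exact: near_ge_ln.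
set L := ln n%:R in L1 L2 *; have L0 : 0 < L by lra.
rewrite mulNr expRN ler_pdivrMr ?expR_gt0 //.
have := expR_ge1Dxn 1 (mulr_ge0 (ltW g0) (ltW L0)).
rewrite (_ : 2`! = 2)%N // => H.
apply: (@le_trans _ _ (epsilon * ((gamma * L) ^+ 2 / 2))); last first.
  by rewrite ler_wpM2l ?(ltW e0) //; apply: le_trans H; rewrite lerDr.
have -> : epsilon * ((gamma * L) ^+ 2 / 2) = L * (L * ((gamma ^+ 2 * epsilon) / 2)).
  by field.
rewrite ler_peMr ?(ltW L0) // -ler_pdivrMr; last by rewrite divr_gt0 ?mulr_gt0 ?exprn_gt0.
by rewrite mul1r invf_div.
Unshelve. all: by end_near. Qed.

End log_limits.

Unset Implicit Arguments.

(** * Uniform integrability and the two limits *)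

Section asymptotics.
Context (R : realType)
    (m : nat -> nat)
    (d : nat -> measure_display) (T : forall n, measurableType (d n))
    (P : forall n, probability (T n) R)
    (X : forall n, 'I_(m n) -> {RV (P n) >-> nat})
    (Q : forall n, 'I_(m n) -> {RV (P n) >-> R})
    (G : forall n, 'I_(m n) -> {RV (P n) >-> community n})
    (istar : forall n, T n -> 'I_(m n))
    (d' : measure_display) (T' : measurableType d') (P' : probability T' R)
    (X' : {RV P' >-> nat}) (Q' : {RV P' >-> R}).
Hypothesis hm : forall n, (0 < n)%N -> (0 < m n)%N.
Hypothesis hG : forall n, (0 < n)%N -> is_community_sequence (X n) (Q n) (G n).
Hypothesis histar : forall n, (0 < n)%N ->
       is_uniform_index (X n) (Q n) (istar n).
Hypothesis hQ' : forall t, 0 <= Q' t <= 1.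
Hypothesis hcvg : cvg_in_distribution P
       (fun n t => (X n (istar n t) t, Q n (istar n t) t) : nat * R)
       P' (fun t => (X' t, Q' t) : nat * R).
Hypothesis hpos : (0 < 'E_P'[fun t => (Q' t * \1_[set s | (2 <= X' s)%N] t)%R])%E.
Hypothesis hfin : ('E_P'[fun t => ((X' t)%:R * hfun (X' t) (Q' t)
                             * ln (1 + (X' t)%:R))%R] < +oo)%E.
Hypothesis hmom : 'E_(P n)[fun t =>
                ((X n (istar n t) t)%:R
                 * hfun (X n (istar n t) t) (Q n (istar n t) t)
                 * ln (1 + (X n (istar n t) t)%:R))%R]%E @[n --> \oo]
            --> 'E_P'[fun t => ((X' t)%:R * hfun (X' t) (Q' t)
                                * ln (1 + (X' t)%:R))%R]%E.

Let Av n c := average (X n) (Q n) c.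
Let E' c := (\int[P']_t (weighted_h c (X' t, Q' t))%:E)%E.
Let xlog (x : nat) : R := x%:R * ln (1 + x%:R).

Let AvE n (c : nat -> R) : (0 < n)%N -> (forall x, 0 <= c x) ->
  ('E_(P n)[fun t => (c (X n (istar n t) t) *
       hfun (X n (istar n t) t) (Q n (istar n t) t))%R] = (Av n c)%:E)%E.
Proof. by move=> n0 c0; rewrite (expectation_uniform_index (hG n n0) (histar n n0)). Qed.

Let xlog_ge0 x : 0 <= xlog x.
Proof. by rewrite mulr_ge0 // ln_ge0 // lerDl. Qed.

Let measurable_E' c : measurable_fun setT (fun t => (weighted_h c (X' t, Q' t))%:E).
Proof.
apply/measurable_EFinP; apply: (measurableT_comp (measurable_weighted_h c)).
exact: measurable_fun_pair.
Qed.

Let E'_ge0 c t : (forall x, 0 <= c x) -> (0 <= (weighted_h c (X' t, Q' t))%:E)%E.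
Proof. by move=> c0; rewrite lee_fin weighted_h_ge0. Qed.

(** For a bounded weight, [weighted_h c] is a bounded continuous test function. *)
Let Av_cvg (c : nat -> R) (M : R) : (forall x, 0 <= c x <= M) ->
  (fun n => Av n c) @ \oo --> fine (E' c) /\ E' c \is a fin_num.
Proof.
move=> cM; have c0 x : 0 <= c x by case/andP: (cM x).
have cM' x : `|c x| <= M by rewrite ger0_norm //; case/andP: (cM x).
have fin : E' c \is a fin_num.
  rewrite ge0_fin_numE; last by apply: integral_ge0 => t _; apply: E'_ge0.
  apply: (@le_lt_trans _ _ (\int[P']_t (cst M%:E t))%E).
    apply: ge0_le_integral => //.
    - by move=> t _; apply: E'_ge0.
    - by move=> t _; rewrite lee_fin (le_trans (ler_norm _)) // weighted_h_bounded.
  rewrite integral_cst // lte_mul_pinfty //.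
    by rewrite lee_fin; have /andP[] := cM 0%N; apply: le_trans.
  by rewrite (le_lt_trans (probability_le1 _ _)) // ltry.
split => //.
have := hcvg _ (@continuous_weighted_h R c) (ex_intro _ M (weighted_h_bounded cM')).
rewrite [X in _ --> X](_ : _ = (fine (E' c))%:E); last first.
  by rewrite fineK // unlock.
move=> H; apply: cvg_EFin_fine; apply: cvg_trans H; apply: near_eq_cvg.
near=> n; have n0 : (0 < n)%N by near: n; exact: nbhs_infty_gt.
rewrite -(AvE _ _ n0 c0) unlock; apply: eq_integral => t _ /=.
by rewrite weighted_hE //; case: (hG n n0).
Unshelve. all: by end_near. Qed.

(** For x >= 2, (1 - q)^(x - 1) <= 1 - q, so h(x, q) >= q and the limit E h(X, Q) is positive. *)
Let near_h_gt0 : exists2 c0 : R, 0 < c0 &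
  \forall n \near \oo, c0 <= Av n (fun=> 1).
Proof.
have [cv fin] := @Av_cvg (fun=> 1) 1 (fun _ => introT andP (conj ler01 (lexx _))).
have l0 : 0 < fine (E' (fun=> 1)).
  rewrite -lte_fin fineK //; apply: lt_le_trans hpos _; rewrite unlock.
  have mS : measurable [set s | (2 <= X' s)%N].
    rewrite (_ : mkset _ = X' @^-1` [set x | (2 <= x)%N]) //.
    exact: measurable_funPTI.
  apply: ge0_le_integral => //.
  - by move=> t _; rewrite lee_fin mulr_ge0 //; case/andP: (hQ' t).
  - by apply/measurable_EFinP; apply: measurable_funM.
  move=> t _; rewrite lee_fin weighted_hE // mul1r indicE.
  have /andP[q0 q1] := hQ' t.
  have [h0 h1] := andP (hfun_itv (X' t) (hQ' t)).
  have [/set_mem/= X2|_] := boolP (t \in _); last by rewrite mulr0.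
  rewrite mulr1 /hfun; case: (X' t) X2 => [|[|x]] //= _.
  rewrite exprS; have : 0 <= (1 - Q' t) ^+ x <= 1.
    by rewrite exprn_ge0 ?exprn_ile1 //; lra.
  by move=> /andP[]; set z := _ ^+ x; nra.
exists (fine (E' (fun=> 1)) / 2); first by rewrite divr_gt0.
by apply: cvgr_ge cv _ _; rewrite ltr_pdivrMr //; lra.
Qed.

Let xlogE : (fun n => Av n xlog) @ \oo --> fine (E' xlog) /\ E' xlog \is a fin_num.
Proof.
have EE : ('E_P'[fun t => ((X' t)%:R * hfun (X' t) (Q' t)
     * ln (1 + (X' t)%:R))%R] = E' xlog)%E.
  rewrite unlock; apply: eq_integral => t _; rewrite weighted_hE //.
  by rewrite /xlog mulrAC.
have fin : E' xlog \is a fin_num.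
  rewrite ge0_fin_numE; last by apply: integral_ge0 => t _; apply: E'_ge0.
  by rewrite -EE.
split => //; move: hmom; rewrite EE -[X in _ --> X -> _]fineK // => H.
apply: cvg_EFin_fine; apply: cvg_trans H; apply: near_eq_cvg.
near=> n; have n0 : (0 < n)%N by near: n; exact: nbhs_infty_gt.
rewrite -(AvE _ _ n0 xlog_ge0); congr expectation.
by apply/funext => t; rewrite /xlog mulrAC.
Unshelve. all: by end_near. Qed.

(** Uniform integrability: the full moment converges by assumption, its truncation [lo K] by
    [Av_cvg], and monotone convergence makes the limit of the truncation close to the full one. *)
Let xlog_tail (epsilon : R) : 0 < epsilon ->
  exists K : nat, \forall n \near \oo,
    Av n (fun x => xlog x * (K < x)%N%:R) <= epsilon.
Proof.
move=> e0; have [cM finM] := xlogE.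
pose lo K x := xlog x * (x <= K)%N%:R.
have lo0 K x : 0 <= lo K x by rewrite mulr_ge0.
have cvK : E' (lo K) @[K --> \oo] --> E' xlog.
  rewrite (_ : E' xlog = \int[P']_t (limn (fun K => (weighted_h (lo K) (X' t, Q' t))%:E)))%E.
    apply: cvg_monotone_convergence => //.
    - by move=> K t _; apply: E'_ge0.
    - move=> t _ K K' KK'; rewrite lee_fin ler_wpM2r //.
        by case/andP: (hfun_itv (X' t) (clamp_itv (Q' t))).
      rewrite ler_wpM2l // ler_nat /=.
      by case: (leqP (X' t) K) => // XK; rewrite (leq_trans XK KK').
  apply: eq_integral => t _; apply/esym/cvg_lim => //.
  apply: cvg_near_cst; near=> K.
  rewrite /weighted_h /lo /= (_ : (X' t <= K)%N) ?mulr1 //.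
  by near: K; exact: nbhs_infty_ge.
have /fine_cvg cvK' : E' (lo K) @[K --> \oo] --> (fine (E' xlog))%:E by rewrite fineK.
(* Three errors of epsilon / 4 will add up: this one, [H1] and [H2]. *)
have [K _ /(_ K (leqnn K)) HK] : \forall K \near \oo, fine (E' xlog) - epsilon / 4 <= fine (E' (lo K)).
  by apply: cvgr_ge cvK' _ _; lra.
exists K.
have [cK _] : (fun n => Av n (lo K)) @ \oo --> fine (E' (lo K)) /\ E' (lo K) \is a fin_num.
  apply: (@Av_cvg _ (\sum_(x < K.+1) xlog x)) => x; rewrite lo0 /lo /=.
  have [xK|xK] := leqP x K; last by rewrite mulr0 sumr_ge0.
  by rewrite mulr1 (bigD1 (Ordinal (xK : (x < K.+1)%N))) //= lerDl sumr_ge0.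
near=> n; have n0 : (0 < n)%N by near: n; exact: nbhs_infty_gt.
have H1 : Av n xlog <= fine (E' xlog) + epsilon / 4.
  by near: n; apply: cvgr_le cM _ _; lra.
have H2 : fine (E' (lo K)) - epsilon / 4 <= Av n (lo K).
  by near: n; apply: cvgr_ge cK _ _; lra.
have H3 : Av n xlog = Av n (lo K) + Av n (fun x => xlog x * (K < x)%N%:R).
  rewrite -(averageD (hG n n0)); congr (average _ _ _).
  apply/funext => x; rewrite /lo -mulrDr -natrD.
  by case: leqP => _; rewrite ?addn0 ?add0n mulr1.
lra.
Unshelve. all: by end_near. Qed.

(** For x >= 1, x <= x ln(1 + x) / ln 2, and the moment on the right converges. *)
Let near_kappa_le : exists2 k1 : R, 0 < k1 &
  \forall n \near \oo, Av n (fun x => x%:R) <= k1.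
Proof.
have [cM finM] := xlogE.
have l2 : 0 < ln (2 : R) by rewrite ln_gt0 // ltr1n.
have M0 : 0 <= fine (E' xlog).
  by apply: fine_ge0; apply: integral_ge0 => t _; apply: E'_ge0.
exists ((ln 2)^-1 * (fine (E' xlog) + 1)).
  by rewrite mulr_gt0 ?invr_gt0 // ltr_wpDl.
near=> n; have n0 : (0 < n)%N by near: n; exact: nbhs_infty_gt.
apply: (@le_trans _ _ ((ln 2)^-1 * Av n xlog)).
  apply: (ler_average (hG n n0)) => x q q01.
  have /andP[h0 h1] := hfun_itv x q01.
  rewrite mulrA ler_wpM2r // /xlog; case: x {h0 h1} => [|x].
    by rewrite !mul0r mulr0.
  rewrite mulrCA ler_peMr // ler_pdivlMl // mulr1 ler_ln ?posrE //.
    by rewrite -[2]/(1 + 1) lerD2l ler1n.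
rewrite ler_wpM2l ?invr_ge0 ?(ltW l2) //.
by near: n; apply: cvgr_le cM _ _; lra.
Unshelve. all: by end_near. Qed.

Let kappa_ge n : (0 < n)%N -> 2 * Av n (fun=> 1) <= Av n (fun x => x%:R).
Proof.
move=> n0; rewrite -ler_pdivlMl //.
apply: (ler_average (hG n n0)) => x q q01.
have [x1|x2] := leqP x 1; first by rewrite hfun_le1 // !mulr0.
have /andP[h0 h1] := hfun_itv x q01.
by rewrite mulrA ler_wpM2r // ler_pdivlMl // mulr1 ler_nat.
Qed.

(** Where x > n^gamma, gamma ln n <= ln(1 + x), so the factor ln n is paid for by the logarithmic
    moment; eventually n^gamma >= gamma ln n >= K, which places this tail beyond [K]. *)
Let near_tail (gamma epsilon : R) : 0 < gamma -> 0 < epsilon ->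
  \forall n \near \oo, ln n%:R *
     Av n (@tail_weight R (expR (gamma * ln n%:R))) <= epsilon.
Proof.
move=> g0 e0; have [K HK] := xlog_tail _ (mulr_gt0 g0 e0).
near=> n; have n0 : (0 < n)%N by near: n; exact: nbhs_infty_gt.
have L0 : 1 <= ln n%:R :> R by near: n; exact: near_ge_ln.
have LK : K%:R / gamma <= ln n%:R :> R by near: n; exact: near_ge_ln.
set L := ln n%:R in L0 LK *.
have gL : 0 < gamma * L by rewrite mulr_gt0 //; lra.
have L00 : 0 < L by lra.
rewrite -ler_pdivlMl // (_ : L^-1 * epsilon = (gamma * L)^-1 * (gamma * epsilon)); last first.
  by field; rewrite !gt_eqF.
apply: (@le_trans _ _ ((gamma * L)^-1 * Av n (fun x => xlog x * (K < x)%N%:R))); last first.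
  rewrite ler_wpM2l ?invr_ge0 ?(ltW gL) //.
  by near: n.
apply: (ler_average (hG n n0)) => x q q01; have /andP[h0 h1] := hfun_itv x q01.
rewrite [leRHS]mulrA ler_wpM2r // /tail_weight /xlog.
case: ltP => bx; last first.
  by rewrite mulr0 !mulr_ge0 ?invr_ge0 ?(ltW gL) // ln_ge0 // lerDl.
have Kx : (K < x)%N.
  rewrite -(ltr_nat R); apply: le_lt_trans bx.
  apply: (@le_trans _ _ (gamma * L)); first by rewrite mulrC -ler_pdivrMr.
  by apply: le_trans (expR_ge1Dx _); rewrite lerDr.
rewrite Kx !mulr1 mulrCA ler_peMr // ler_pdivlMl // mulr1.
rewrite -[leLHS]expRK ler_ln ?posrE ?expR_gt0 //.
by apply: le_trans (ltW bx) _; rewrite lerDr.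
Unshelve. all: by end_near. Qed.

Let lambda n : R := ln n%:R - (m n)%:R / n%:R * Av n (fun x => x%:R).

Let prob_connected n :=
  P n [set t | connected_graph (affiliation_edges (fun i => G n i t))].

Lemma prob_connected_cvg0 :
  lambda n @[n --> \oo] --> +oo -> prob_connected n @[n --> \oo] --> 0%E.
Proof.
move=> hl; have [c0 c00 Hc] := near_h_gt0.
pose s n : R := ln n%:R * expR (- ln n%:R / 2) +
  ln n%:R * Av n (@tail_weight R (expR (ln n%:R / 2))) / c0.
have s_le (e : R) : 0 < e -> \forall n \near \oo, s n <= e.
  move=> e0; near=> n.
  have H1 : ln n%:R * expR (- 2^-1 * ln n%:R) <= e / 2.
    by near: n; apply: near_ln_expR => //; rewrite divr_gt0.
  have H2 : ln n%:R * Av n (@tail_weight R (expR (2^-1 * ln n%:R))) <= (e / 2) * c0.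
    by near: n; apply: near_tail => //; rewrite !mulr_gt0.
  rewrite /s mulNr [ln n%:R / 2]mulrC -mulNr.
  have : ln n%:R * Av n (@tail_weight R (expR (2^-1 * ln n%:R))) / c0 <= e / 2.
    by rewrite ler_pdivrMr.
  by move: H1; lra.
have s_ge : \forall n \near \oo, 0 <= s n.
  near=> n; have L0 : 0 <= ln n%:R :> R by near: n; exact: near_ge_ln.
  apply: addr_ge0; first by rewrite mulr_ge0 ?expR_ge0.
  apply: divr_ge0; last exact: ltW.
  by apply: mulr_ge0 => //; apply: average_ge0 => x; rewrite mulr_ge0.
have s0 : s n @[n --> \oo] --> 0.
  apply/cvgrPdist_le => e e0; near=> n; rewrite sub0r normrN ger0_norm.
    by near: n; exact: s_le.
  by near: n.
(* The factor exp(2 s) is replaced by e, since eventually s <= 1/2. *)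
pose u n := expR (- lambda n) * expR 1 + expR (6 * s n) - 1.
have u0 : (u n)%:E @[n --> \oo] --> 0%E.
  apply: cvg_EFin; first by near=> n.
  have -> : 0 = 0 * expR 1 + expR (6 * 0) - 1 :> R by rewrite mulr0 expR0; ring.
  apply: cvgB; last exact: cvg_cst.
  apply: cvgD.
    apply: cvgM; last exact: cvg_cst.
    exact: (cvg_comp _ _ hl (@cvgr_expR R)).
  apply: continuous_cvg; first exact: continuous_expR.
  by apply: cvgM => //; exact: cvg_cst.
apply: squeeze_cvge u0; last first.
  exact: (cvg_cst 0%E).
near=> n; rewrite measure_ge0 /=.
have n1 : (1 < n)%N by near: n; exact: nbhs_infty_gt.
have n0 := ltnW n1.
have s2 : s n <= 2^-1 by near: n; apply: s_le; rewrite invr_gt0.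
apply: le_trans (connected_prob_le (hG n n0) n1 (hm n n0) (k0 := c0) _ _ _ _ s2) _ => //.
- apply: le_trans (kappa_ge n n0); have : c0 <= Av n (fun=> 1) by near: n.
  by move: c00; lra.
- by near: n; move/cvgryPge: hl; exact.
- by near: n; exact: near_ge_ln.
rewrite lee_fin /u lerD2r lerD2r -expRD ler_expR -/(lambda n) lerD2l.
have : 2 * s n <= 1 by lra.
exact.
Unshelve. all: by end_near. Qed.

Lemma prob_connected_cvg1 :
  lambda n @[n --> \oo] --> -oo -> prob_connected n @[n --> \oo] --> 1%E.
Proof.
move=> hl; have [c0 c00 Hc] := near_h_gt0; have [k1 k10 Hk] := near_kappa_le.
(* This makes 2 gamma <= E h(X, Q) / kappa_n, which compensates the binomial
   coefficients C(n, k) with k > n^(1 - gamma). *)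
pose gamma := c0 / (2 * k1).
have g0 : 0 < gamma by rewrite divr_gt0 // mulr_gt0.
have g20 : 0 < gamma / 2 by rewrite divr_gt0.
have gk : 2 * gamma * k1 = c0 by rewrite /gamma; field; rewrite gt_eqF.
pose rho n := expR (lambda n / 2 + 1) + expR (1 - gamma * ln n%:R).
(* Both exponents tend to minus infinity; each exponential is brought below e / 2. *)
have rho_le (e : R) : 0 < e -> \forall n \near \oo, rho n <= e.
  move=> e0; have e20 : 0 < e / 2 by rewrite divr_gt0.
  near=> n.
  have H1 : lambda n <= 2 * (ln (e / 2) - 1) by near: n; move/cvgrNyPle: hl; exact.
  have H2 : (1 - ln (e / 2)) / gamma <= ln n%:R by near: n; exact: near_ge_ln.
  have -> : e = expR (ln (e / 2)) + expR (ln (e / 2)) by rewrite lnK ?posrE //; lra.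
  rewrite lerD // ler_expR; first by move: H1; lra.
  by move: H2; rewrite ler_pdivrMr // mulrC; lra.
have rho0 : rho n @[n --> \oo] --> 0.
  apply/cvgrPdist_le => e e0; near=> n.
  rewrite sub0r normrN ger0_norm ?addr_ge0 ?expR_ge0 //.
  by near: n; exact: rho_le.
have u1 : (1 - 2 * rho n)%:E @[n --> \oo] --> 1%E.
  apply: cvg_EFin; first by near=> n.
  have : (1 - 2 * rho n) @[n --> \oo] --> (1 - 2 * 0 : R).
    by apply: cvgB; [exact: cvg_cst|apply: cvgM => //; exact: cvg_cst].
  by rewrite mulr0 subr0.
apply: (squeeze_cvge _ u1 (cvg_cst 1%E)).
near=> n.
have n1 : (1 < n)%N by near: n; exact: nbhs_infty_gt.
have n0 := ltnW n1.
rewrite (connected_prob_le1 (hG n n0)) andbT.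
have L1 : 1 <= ln n%:R :> R by near: n; exact: near_ge_ln.
have cn : c0 <= Av n (fun=> 1) by near: n.
(* Two errors of 1/4 give theta L <= 1/2, which implies theta <= 1/2 as well because L >= 1. *)
have H1 : ln n%:R * expR (- (gamma / 2) * ln n%:R) <= 4^-1.
  by near: n; apply: near_ln_expR.
have H2 : ln n%:R * Av n (@tail_weight R (expR (gamma / 2 * ln n%:R))) <= 4^-1 * c0.
  by near: n; apply: near_tail => //; rewrite mulr_gt0.
have gE : gamma / 2 * ln n%:R = gamma * ln n%:R / 2 :> R by rewrite mulrAC.
have thL : ln n%:R * (expR (- gamma * ln n%:R / 2) +
    Av n (@tail_weight R (expR (gamma * ln n%:R / 2))) / c0) <= 2^-1.
  rewrite mulrDr !mulNr -gE -mulNr mulrA.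
  have : ln n%:R * Av n (@tail_weight R (expR (gamma / 2 * ln n%:R))) / c0 <= 4^-1.
    by rewrite ler_pdivrMr.
  by move: H1; lra.
have th0 : 0 <= expR (- gamma * ln n%:R / 2) +
    Av n (@tail_weight R (expR (gamma * ln n%:R / 2))) / c0.
  rewrite addr_ge0 ?expR_ge0 // divr_ge0 ?(ltW c00) //.
  by apply: average_ge0 => x; rewrite mulr_ge0.
apply: (connected_prob_ge (hG n n0) n1 (hm n n0) (k0 := c0) (k1 := k1) (gamma := gamma)) => //.
- by apply: le_trans (kappa_ge n n0); have := c00; move: cn; lra.
- by near: n.
- by rewrite gk.
- by lra.
- by near: n; move/cvgrNyPle: hl; exact.
- by apply: le_trans thL; rewrite ler_peMl.
- by rewrite mulrC; apply: le_trans thL _; rewrite invf_le1 // ler1n.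
- by near: n; apply: rho_le; rewrite invr_gt0.
Unshelve. all: by end_near. Qed.

End asymptotics.

Theorem theorem1 (R : realType)
    (m : nat -> nat)
    (d : nat -> measure_display) (T : forall n, measurableType (d n))
    (P : forall n, probability (T n) R)
    (X : forall n, 'I_(m n) -> {RV (P n) >-> nat})
    (Q : forall n, 'I_(m n) -> {RV (P n) >-> R})
    (G : forall n, 'I_(m n) -> {RV (P n) >-> community n})
    (istar : forall n, T n -> 'I_(m n))
    (d' : measure_display) (T' : measurableType d') (P' : probability T' R)
    (X' : {RV P' >-> nat}) (Q' : {RV P' >-> R})
    (hm : forall n, (0 < n)%N -> (0 < m n)%N)
    (hm_oo : m n @[n --> \oo] --> \oo)
    (hG : forall n, (0 < n)%N -> is_community_sequence (X n) (Q n) (G n))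
    (histar : forall n, (0 < n)%N ->
       is_uniform_index (X n) (Q n) (istar n))
    (hQ' : forall t, 0 <= Q' t <= 1)
    (hcvg : cvg_in_distribution P
       (fun n t => (X n (istar n t) t, Q n (istar n t) t) : nat * R)
       P' (fun t => (X' t, Q' t) : nat * R))
    (hpos : (0 < 'E_P'[fun t => (Q' t * \1_[set s | (2 <= X' s)%N] t)%R])%E)
    (hfin : ('E_P'[fun t => ((X' t)%:R * hfun (X' t) (Q' t)
                             * ln (1 + (X' t)%:R))%R] < +oo)%E)
    (hmom : 'E_(P n)[fun t =>
                ((X n (istar n t) t)%:R
                 * hfun (X n (istar n t) t) (Q n (istar n t) t)
                 * ln (1 + (X n (istar n t) t)%:R))%R]%E @[n --> \oo]
            --> 'E_P'[fun t => ((X' t)%:R * hfun (X' t) (Q' t)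
                                * ln (1 + (X' t)%:R))%R]%E) :
  let kappa := fun n : nat =>
    fine 'E_(P n)[fun t =>
      ((X n (istar n t) t)%:R
       * hfun (X n (istar n t) t) (Q n (istar n t) t))%R]%E in
  let lambda := fun n : nat =>
    ln n%:R - (m n)%:R / n%:R * kappa n : R in
  let prob_connected := fun n : nat =>
    P n [set t | connected_graph
                   (affiliation_edges (fun i => G n i t))] in
  (lambda n @[n --> \oo] --> +oo ->
     prob_connected n @[n --> \oo] --> 0%E) /\
  (lambda n @[n --> \oo] --> -oo ->
     prob_connected n @[n --> \oo] --> 1%E).
Proof.
move=> kappa lambda prob_connected.
(* The two expressions for kappa_n are identified for n > 0 only, hence the eventual equality. *)
have lambdaE : \forall n \near \oo, ln n%:R - (m n)%:R / n%:R *
    average (X n) (Q n) (fun x => x%:R) = lambda n.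
  near=> n; have n0 : (0 < n)%N by near: n; exact: nbhs_infty_gt.
  rewrite /lambda /kappa.
  by rewrite (expectation_uniform_index (hG n n0) (histar n n0)
    (fun x => ler0n R x)).
split=> hl.
  apply: (prob_connected_cvg0 R m d T P X Q G istar d' T' P' X' Q') => //.
  by apply: cvg_trans hl; apply: near_eq_cvg; near do apply/esym.
apply: (prob_connected_cvg1 R m d T P X Q G istar d' T' P' X' Q') => //.
by apply: cvg_trans hl; apply: near_eq_cvg; near do apply/esym.
Unshelve. all: by end_near. Qed.
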